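(* Let $F$ be an algebraically closed field of characteristic $p\ge3$, let $(\lambda|p\mu)\in\mathcal P^2(n)$ and $\rho=\mathrm{P}(\lambda|p\mu)$. Then every Sylow $p$-subgroup of the Young subgroup $\mathfrak S_\rho$ is a Green vertex of $Y(\lambda|p\mu)$, and $Y(\lambda|p\mu)$ has trivial Green source.
   Context: $Y(\lambda|p\mu)$ is Donkin's indecomposable signed Young module: the unique indecomposable summand of multiplicity one of $M(\lambda|p\mu)=\mathrm{Ind}_{\mathfrak S_\lambda\times\mathfrak S_{p\mu}}^{\mathfrak S_n}(F\boxtimes\mathrm{sgn})$ whose complementary indecomposable summands all occur in $M(\alpha|p\beta)$ with $(\alpha|p\beta)$ strictly dominating $(\lambda|p\mu)$ (dominance on pairs: $(\lambda|\zeta)\unrhd(\alpha|\beta)$ iff for all $k$, $\sum_{i\le k}\lambda_i\ge\sum_{i\le k}\alpha_i$ and $|\lambda|+\sum_{i\le k}\zeta_i\ge|\alpha|+\sum_{i\le k}\beta_i$). Write $\lambda=\sum_{i=0}^{r_\lambda}p^i\lambda(i)$, $\mu=\sum_{i=0}^{r_\mu}p^i\mu(i)$ for the $p$-adic expansions (unique, with each $\lambda(i),\mu(i)$ $p$-restricted, i.e. consecutive parts differ by less than $p$, and top term nonempty; $r=0$ for the empty partition). Put $r=\max\{r_\lambda,r_\mu+1\}$, $\mu(-1)=\varnothing$, and $\mathrm{P}(\lambda|p\mu)$ the composition $(1^{n_0},p^{n_1},(p^2)^{n_2},\dots,(p^r)^{n_r})$ with $n_i=|\lambda(i)|+|\mu(i-1)|$.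 For a composition $\rho=(\rho_1,\dots,\rho_k)$, $\mathfrak S_\rho=\mathfrak S_{\rho_1}\times\cdots\times\mathfrak S_{\rho_k}\le\mathfrak S_n$. *)

(* Defs.v *)
From HB Require Import structures.
From mathcomp Require Import all_boot all_order all_algebra all_fingroup.
From mathcomp Require Import all_solvable all_field all_character.
Set Implicit Arguments. Unset Strict Implicit. Unset Printing Implicit Defensive.
Import Order.TTheory GRing.Theory Num.Theory.
Local Open Scope ring_scope.

Definition is_partition (s : seq nat) : bool :=
  sorted geq s && all (fun x => 0 < x)%N s.

(* p-restricted: consecutive parts differ by less than p (the last part is
   compared with 0, i.e. the partition is padded by zeros) *)
Definition p_restricted (p : nat) (s : seq nat) : bool :=
  [forall j : 'I_(size s), (nth 0 s j - nth 0 s j.+1 < p)%N].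

Definition padd (s t : seq nat) : seq nat :=
  mkseq (fun j => nth 0 s j + nth 0 t j)%N (maxn (size s) (size t)).
Definition pscale (k : nat) (s : seq nat) : seq nat := map (muln k) s.

Definition psum (p : nat) (ls : seq (seq nat)) : seq nat :=
  foldr (fun l acc => padd l (pscale p acc)) [::] ls.

Definition padic_expansion (p : nat) (lam : seq nat) (ls : seq (seq nat)) :=
  [/\ all is_partition ls, all (p_restricted p) ls, (0 < size ls)%N,
      size ls = 1%N \/ last [::] ls != [::] & lam = psum p ls].

(* the composition P(lam|p mu) = (1^{n_0}, p^{n_1}, ..., (p^r)^{n_r}),
   computed from the expansions ls of lam and ms of mu;
   r_lam = size ls - 1, r_mu + 1 = size ms *)
Definition Pcomp (p : nat) (ls ms : seq (seq nat)) : seq nat :=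
  let r := maxn (size ls).-1 (size ms) in
  flatten [seq nseq (sumn (nth [::] ls i) +
                     (if i is i'.+1 then sumn (nth [::] ms i') else 0))%N
                    (p ^ i)%N | i <- iota 0 r.+1].

Definition pair_dom (lz ab : seq nat * seq nat) : bool :=
  let: (lam, zeta) := lz in let: (al, be) := ab in
  [forall k : 'I_(size lam + size zeta + size al + size be).+1,
     (sumn (take k al) <= sumn (take k lam))%N &&
     (sumn al + sumn (take k be) <= sumn lam + sumn (take k zeta))%N].
Definition pair_sdom (lz ab : seq nat * seq nat) : bool :=
  pair_dom lz ab && (lz != ab).

(* index of the block (of consecutive points) of the composition rho
   containing the point i *)
Definition blk (rho : seq nat) (i : nat) : nat :=
  count (fun k => sumn (take k.+1 rho) <= i)%N (iota 0 (size rho)).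

Definition young_set (n : nat) (rho : seq nat) : {set 'S_n} :=
  [set s : 'S_n | [forall i : 'I_n, blk rho (s i) == blk rho i]].

Lemma young_group_set n rho : group_set (young_set n rho).
Proof.
apply/group_setP; split; first by rewrite inE; apply/forallP=> i; rewrite perm1.
move=> x y; rewrite !inE => /forallP Hx /forallP Hy; apply/forallP=> i.
by rewrite permM (eqP (Hy _)) (eqP (Hx _)).
Qed.
Canonical young (n : nat) (rho : seq nat) : {group 'S_n} :=
  Group (young_group_set n rho).

Section Reps.
Variables (F : fieldType) (gT : finGroupType).
Local Notation G := [set: gT]%G.

Section DSum.
Variables (H : {group gT}) (n1 n2 : nat).
Variables (r1 : mx_representation F H n1) (r2 : mx_representation F H n2).
Definition dsum_mx (g : gT) : 'M[F]_(n1 + n2) := block_mx (r1 g) 0 0 (r2 g).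
Lemma dsum_mx_repr : mx_repr H dsum_mx.
Proof.
split; first by rewrite /dsum_mx !repr_mx1 -scalar_mx_block.
move=> x y Hx Hy; rewrite /dsum_mx mulmx_block !repr_mxM //.
by rewrite !mulmx0 !mul0mx !addr0 !add0r.
Qed.
Definition dsum_repr := MxRepresentation dsum_mx_repr.
End DSum.

Definition summand (H : {group gT}) m n
    (rM : mx_representation F H m) (rV : mx_representation F H n) : Prop :=
  exists k (rN : mx_representation F H k), mx_rsim (dsum_repr rM rN) rV.

Definition indecomposable (H : {group gT}) m (rM : mx_representation F H m)
    : Prop :=
  (0 < m)%N /\
  forall m1 m2 (r1 : mx_representation F H m1) (r2 : mx_representation F H m2),
    mx_rsim (dsum_repr r1 r2) rM -> m1 = 0%N \/ m2 = 0%N.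

(* rW (an FG-module, G the whole group gT) is induced from the FH-module rV
   (Serre's definition): W contains an H-submodule U affording rV such that
   W is the direct sum of the translates U g over a set of representatives g
   of the cosets H g; equivalently the translates span W and
   dim W = [G : H] dim U. *)
Definition induced_from (H : {group gT}) m (rV : mx_representation F H m)
    n (rW : mx_representation F G n) : Prop :=
  exists U : 'M[F]_n,
    [/\ exists modU : mxmodule (subg_repr rW (subsetT H)) U,
          mx_rsim (submod_repr modU) rV,
        row_full (\big[addsmx/0]_(g in G) (U *m rW g))%MS &
        (\rank U * #|G : H|%g)%N = n].

Definition summand_of_induced m (rM : mx_representation F G m)
    (H : {group gT}) k (rV : mx_representation F H k) : Prop :=
  exists n (rW : mx_representation F G n), induced_from rV rW /\ summand rM rW.

Definition rel_projective m (rM : mx_representation F G m) (H : {group gT}) :=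
  summand_of_induced rM (subg_repr rM (subsetT H)).

Definition vertex m (rM : mx_representation F G m) (Q : {group gT}) : Prop :=
  rel_projective rM Q /\
  forall R : {group gT}, R \proper Q -> ~ rel_projective rM R.

Lemma triv_mx_repr (H : {group gT}) : mx_repr H (fun _ : gT => 1%:M : 'M[F]_1).
Proof. by split=> // x y _ _; rewrite mul1mx. Qed.
Definition triv_repr (H : {group gT}) := MxRepresentation (triv_mx_repr H).

Definition trivial_source_at m (rM : mx_representation F G m)
    (Q : {group gT}) : Prop :=
  summand_of_induced rM (triv_repr Q).

End Reps.

Section Signed.
Variables (F : fieldType) (n : nat).

Definition tail_points (rho : seq nat) (k : nat) : {set 'I_n} :=
  [set i : 'I_n | (k <= blk rho i)%N].

Lemma young_sub_stab rho k :
  (young n rho \subset 'N(tail_points rho k | 'P))%g.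
Proof.
apply/subsetP=> s; rewrite inE => /forallP Hs.
apply/astabsP=> i; rewrite /= !inE.
by rewrite (eqP (Hs i)).
Qed.

(* F boxtimes sgn on S_rho, where sgn is the sign of the component of the
   permutation acting on the blocks of index >= k *)
Definition tsgn_mx (rho : seq nat) (k : nat) (g : 'S_n) : 'M[F]_1 :=
  ((-1) ^+ odd_perm (restr_perm (tail_points rho k) g))%:M.

Lemma tsgn_mx_repr rho k : mx_repr (young n rho) (tsgn_mx rho k).
Proof.
split; first by rewrite /tsgn_mx morph1 odd_perm1.
move=> x y Hx Hy; rewrite /tsgn_mx.
have sub := subsetP (young_sub_stab rho k).
rewrite morphM ?sub //= odd_permM signr_addb scalar_mxM //.
Qed.
Definition tsgn_repr rho k := MxRepresentation (tsgn_mx_repr rho k).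

Definition is_signed_perm_module (p : nat) (lam mu : seq nat) d
    (rW : mx_representation F [set: 'S_n]%G d) : Prop :=
  induced_from (tsgn_repr (lam ++ pscale p mu) (size lam)) rW.

(* rY is (isomorphic to) Donkin's signed Young module Y(lam|p mu):
   an indecomposable summand of M(lam|p mu), of multiplicity one, whose
   complement has all its indecomposable summands occurring in some
   M(al|p be) with (al|p be) strictly dominating (lam|p mu). *)
Definition is_signed_young_module (p : nat) (lam mu : seq nat) d
    (rY : mx_representation F [set: 'S_n]%G d) : Prop :=
  indecomposable rY /\
  exists dM (rM : mx_representation F [set: 'S_n]%G dM)
         dN (rN : mx_representation F [set: 'S_n]%G dN),
  [/\ is_signed_perm_module p lam mu rM,
      mx_rsim (dsum_repr rY rN) rM,
      ~ summand rY rN &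
      forall dX (rX : mx_representation F [set: 'S_n]%G dX),
        indecomposable rX -> summand rX rN ->
        exists (al be : seq nat),
          [/\ is_partition al, is_partition be,
              (sumn al + p * sumn be)%N = n,
              pair_sdom (al, pscale p be) (lam, pscale p mu) &
              exists dV (rV : mx_representation F [set: 'S_n]%G dV),
                is_signed_perm_module p al be rV /\ summand rX rV]].

End Signed.

(* Main.v *)
(* Modulo p, signed permutation modules restricted to a p-group are permutation modules,
   so vertices can be read off from Brauer quotients. The blocks of P(lambda|p mu), which
   are the orbits of Q, are indexed by the boxes of the diagrams of the lambda(i) and the
   mu(i - 1). Let L be the subgroup of N(Q) permuting the blocks within each column, and
   chi(l) the product of the sign of l on the set of blocks and of its sign on the points
   in boxes of the mu(i - 1). Pair the vectors v of a module on which L acts by chi with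
   its Q-invariant functionals f. For M(alpha|p beta), only the Q-fixed cosets contribute
   to v f. Such a coset distributes the blocks over the rows of alpha and p beta; it
   contributes 0 unless the blocks of the mu(i - 1) lie in rows of p beta, and no two
   blocks of a column share a row (single points of lambda(0) may share a row of p beta).
   This forces (lambda|p mu) to dominate (alpha|p beta). So the pairing vanishes on the complement of Y in M = M(lambda|p mu), while it has rank one on
   M; being nonzero on Y, it shows that Y is not projective relative to a proper subgroup
   of Q. Let sigma in L reverse the columns, and let E be the stabilizer of both the rows
   and their images under sigma. As the lambda(i) and mu(i) are p-restricted, Q is a Sylow
   subgroup of E, and then a trace from Q defined with sigma is an endomorphism theta of M
   that factors through Ind_Q F and acts on the pairing by the scalar [E : Q] up to sign,
   which is not 0. So theta induces a non-nilpotent endomorphism of Y, hence an invertible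
   one by Fitting's lemma, and Y is a summand of Ind_Q F. *)
Require Import Defs.
From HB Require Import structures.
From mathcomp Require Import all_boot all_order all_algebra all_fingroup.
From mathcomp Require Import all_solvable all_field all_character.
From mathcomp Require Import ring.
Set Implicit Arguments. Unset Strict Implicit. Unset Printing Implicit Defensive.
Import Order.TTheory GRing.Theory Num.Theory.
Local Open Scope ring_scope.

(** * Coset sums and relative traces *)

Section CosetSums.
Variable gT : finGroupType.
Implicit Types (H Q : {group gT}).

(** Meaningful for [f] constant on the right cosets of [H], when the choice of representatives does
    not matter. *)
Definition coset_sum (V : nmodType) (H : {group gT}) (f : gT -> V) : V :=
  \sum_(C in rcosets H [set: gT]) f (repr C).

Lemma coset_invP H (T : Type) (f : gT -> T) (C : {set gT}) x :
  (forall h y, h \in H -> f (h * y)%g = f y) ->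
  C \in rcosets H [set: gT] -> x \in C -> f (repr C) = f x.
Proof.
move=> fH /rcosetsP[y _ ->] xC.
case/rcosetP: (mem_repr x xC) => h hH ->; case/rcosetP: xC => k kH ->.
by rewrite !fH.
Qed.

Lemma rcosetsE H (C : {set gT}) x :
  C \in rcosets H [set: gT] -> x \in C -> C = (H :* x)%g.
Proof. by case/rcosetsP=> y _ -> /rcoset_eqP. Qed.

Lemma repr_rcosets H C : C \in rcosets H [set: gT] -> repr C \in C.
Proof. by case/rcosetsP=> y _ ->; apply: mem_repr (rcoset_refl _ _). Qed.

Lemma coset_sum_shift (V : nmodType) H (f : gT -> V) y :
  (forall h x, h \in H -> f (h * x)%g = f x) ->
  coset_sum H (fun x => f (x * y)%g) = coset_sum H f.
Proof.
move=> fH; rewrite /coset_sum.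
rewrite [RHS](reindex (fun C : {set gT} => C :* y)%g) /=; last first.
  apply: onW_bij; exists (fun C : {set gT} => C :* y^-1)%g => C.
    by rewrite rcosetK.
  by rewrite rcosetKV.
apply: eq_big => [C | C CH].
  apply/rcosetsP/rcosetsP=> [] [x _ defC].
    by exists (x * y)%g; rewrite ?inE // defC rcosetM.
  by exists (x * y^-1)%g; rewrite ?inE // rcosetM -defC rcosetK.
apply/esym/(coset_invP fH); last by rewrite mem_rcoset mulgK (repr_rcosets CH).
case/rcosetsP: CH => x _ ->; apply/rcosetsP; exists (x * y)%g; rewrite ?inE //.
by rewrite rcosetM.
Qed.

Lemma coset_sum_lcoset1 (V : nmodType) H (f : gT -> V) :
  (forall h x, h \in H -> f (h * x)%g = f x) ->
  (forall x, x \notin H -> f x = 0) -> coset_sum H f = f 1%g.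
Proof.
move=> fH f0; rewrite /coset_sum (bigD1 (H : {set gT})) /=; last first.
  by apply/rcosetsP; exists 1%g; rewrite ?inE ?rcoset1.
rewrite big1 ?addr0 => [|C /andP[CH neC]]; last first.
  apply: f0; apply: contra neC => CrH.
  by rewrite (rcosetsE CH (repr_rcosets CH)) rcoset_id.
apply: (coset_invP fH) => //.
by apply/rcosetsP; exists 1%g; rewrite ?inE ?rcoset1.
Qed.

(** [Q] permutes the right cosets of [H] and [f] is constant on its orbits. A nontrivial orbit has
    size divisible by [p] and contributes 0; a fixed coset [H x] satisfies [Q <= H^x], where [f]
    vanishes. *)
Lemma coset_sum_pgroup0 (F : fieldType) p H Q (f : gT -> F) :
    p \in [pchar F] -> (p.-group Q)%g ->
    (forall h x, h \in H -> f (h * x)%g = f x) ->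
    (forall q x, q \in Q -> f (x * q)%g = f x) ->
    (forall x, Q \subset H :^ x -> f x = 0)%g ->
  coset_sum H f = 0.
Proof.
move=> chp pQ fH fQ f0; rewrite /coset_sum.
have actsQ : [acts Q, on rcosets H [set: gT] | 'Rs].
  apply/actsP => q Qq C; apply/rcosetsP/rcosetsP=> [] [x _ /= defC].
    exists (x * q^-1)%g; rewrite ?inE // rcosetM -defC rcosetE.
    by rewrite rcosetK.
  by exists (x * q)%g; rewrite ?inE //= defC rcosetE rcosetM.
rewrite (partition_big (orbit 'Rs%act Q)
  [in orbit 'Rs%act Q @: rcosets H [set: gT]]) /=; last first.
  by move=> C CH; apply: imset_f.
apply: big1 => _ /imsetP[C CH ->].
rewrite (eq_bigr (fun _ => f (repr C))); last first.
  move=> D /andP[DH /eqP/orbit_eqP].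
  case/orbitP=> q Qq /= defD; rewrite -[RHS](fQ q) //.
  apply: (coset_invP fH) => //.
  by rewrite -defD rcosetE mem_rcoset mulgK (repr_rcosets CH).
rewrite sumr_const.
have [fixC | nfixC] := boolP (Q \subset H :^ repr C)%g; first by rewrite f0 ?mul0rn.
set n := #|_|; suff: (p %| n)%N by case/dvdnP=> k ->; rewrite mulrnA mulrn_pchar.
have -> : n = #|orbit 'Rs%act Q C|.
  apply: eq_card => D; apply/andP/idP=> [[_ /eqP<-] | DC].
    exact: orbit_refl.
  split; last by apply/eqP/orbit_eqP.
  by rewrite -(acts_sub_orbit C actsQ) in CH; apply: (subsetP CH).
rewrite card_orbit.
have pi_idx : (p.-nat #|Q : 'C_Q[C | 'Rs]|)%g.
  by apply: pnat_dvd pQ; apply: dvdn_indexg.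
case/p_natP: pi_idx => [[|k] idxE]; last by rewrite idxE expnS dvdn_mulr.
move/eqP: idxE; rewrite expn0 indexg_eq1 subsetI subxx /= => fixQ.
case/negP: nfixC; apply/subsetP=> q Qq; rewrite mem_conjg.
move/subsetP/(_ q Qq): fixQ => /astab1P /= defC.
(* From [C q = C] with [t] in [C] follows [t q t^-1] in [H], that is, [q] in [H^t]. *)
have := repr_rcosets CH; set t := repr C => tC.
have : (t * q)%g \in (C :* q)%g by rewrite mem_rcoset mulgK.
rewrite -rcosetE defC; case/rcosetsP: CH tC => x _ ->; rewrite !mem_rcoset => tx tqx.
rewrite /conjg invgK mulgA.
have -> : (t * q * t^-1 = (t * q * x^-1) * (t * x^-1)^-1)%g.
  by rewrite invMg invgK !mulgA mulgKV.
by rewrite groupM ?groupV.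
Qed.

End CosetSums.

(** * Relative traces and the construction of induced modules *)

Section RelativeTrace.
Variables (F : fieldType) (gT : finGroupType).
Local Notation G := [set: gT]%G.
Local Notation reprG := (mx_representation F G).

Definition hom_of (H : {group gT}) m n (r1 : gT -> 'M[F]_m) (r2 : gT -> 'M[F]_n)
  (X : 'M[F]_(m, n)) : Prop := forall h, h \in H -> r1 h *m X = X *m r2 h.

Definition rel_trace (H : {group gT}) m n (r1 : reprG m) (r2 : reprG n)
    (X : 'M[F]_(m, n)) : 'M[F]_(m, n) :=
  coset_sum H (fun g => r1 g^-1%g *m X *m r2 g).

Lemma reprGM n (r : reprG n) x y : r (x * y)%g = r x *m r y.
Proof. by rewrite repr_mxM ?inE. Qed.

Lemma rel_trace_inv (H : {group gT}) m n (r1 : reprG m) (r2 : reprG n) X :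
  hom_of H r1 r2 X -> forall h x, h \in H ->
  r1 (h * x)^-1%g *m X *m r2 (h * x)%g = r1 x^-1%g *m X *m r2 x.
Proof.
move=> homX h x Hh; rewrite invMg !reprGM !mulmxA.
rewrite -2!(mulmxA (r1 x^-1)%g) homX ?groupV // -!mulmxA; congr (_ *m (_ *m _)).
by rewrite mulmxA -reprGM mulVg repr_mx1 mul1mx.
Qed.

Lemma rel_trace_hom (H : {group gT}) m n (r1 : reprG m) (r2 : reprG n) X :
  hom_of H r1 r2 X -> hom_of G r1 r2 (rel_trace H r1 r2 X).
Proof.
move=> homX g _.
rewrite /rel_trace -[X in _ *m X = _](coset_sum_shift g (rel_trace_inv homX)).
rewrite /coset_sum mulmx_sumr mulmx_suml; apply: eq_bigr => C _.
by rewrite invMg !reprGM !mulmxA -reprGM mulgV repr_mx1 mul1mx.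
Qed.

Lemma mul_rel_trace (H : {group gT}) k m n (r0 : reprG k) (r1 : reprG m)
    (r2 : reprG n) (T : 'M_(k, m)) X :
  hom_of G r0 r1 T -> T *m rel_trace H r1 r2 X = rel_trace H r0 r2 (T *m X).
Proof.
move=> homT; rewrite /rel_trace /coset_sum mulmx_sumr; apply: eq_bigr => C _.
by rewrite !mulmxA -homT ?inE.
Qed.

Lemma rel_trace_mul (H : {group gT}) k m n (r0 : reprG k) (r1 : reprG m)
    (r2 : reprG n) (T : 'M_(n, k)) X :
  hom_of G r2 r0 T -> rel_trace H r1 r2 X *m T = rel_trace H r1 r0 (X *m T).
Proof.
move=> homT; rewrite /rel_trace /coset_sum mulmx_suml; apply: eq_bigr => C _.
by rewrite -!mulmxA homT ?inE.
Qed.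

(* W is identified with the module induced from V by the inclusion [E] of V as
   the summand indexed by the coset H and the projection [P] onto it. *)
Definition induction_system (H : {group gT}) m (rV : mx_representation F H m)
    n (rW : reprG n) (E : 'M[F]_(m, n)) (P : 'M[F]_(n, m)) : Prop :=
  [/\ hom_of H rV rW E, hom_of H rW rV P,
      forall g, E *m rW g *m P = if g \in H then rV g else 0
    & rel_trace H rW rW (P *m E) = 1%:M].

Section Induced.
Variables (H : {group gT}) (m : nat) (rV : mx_representation F H m).

Let k := #|rcosets H [set: gT]|.
Let t (i : 'I_k) : gT := repr (enum_val i).
(** [rV] extended by zero outside [H]. Block [(i, j)] of the induced representation at [g] is
    [B (t i * g) (t j)]. *)
Let B (x y : gT) : 'M[F]_m :=
  if (x * y^-1)%g \in H then rV (x * y^-1)%g else 0.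

Let tP i : enum_val i = (H :* t i)%g.
Proof. by apply: rcosetsE (enum_valP i) (repr_rcosets _); apply: enum_valP. Qed.

Let B_shift x y g : B (x * g)%g y = B x (y * g^-1)%g.
Proof. by rewrite /B invMg invgK !mulgA. Qed.

Let B_left h x y : h \in H -> B (h * x)%g y = rV h *m B x y.
Proof.
move=> Hh; rewrite /B -mulgA (groupMl _ Hh).
by case: ifP => [Hxy | _]; rewrite ?mulmx0 // (repr_mxM rV Hh Hxy).
Qed.

Let B_right h x y : h \in H -> B x (h^-1 * y)%g = B x y *m rV h.
Proof.
move=> Hh; rewrite /B invMg invgK mulgA (groupMr _ Hh).
by case: ifP => [Hxy | _]; rewrite ?mul0mx // (repr_mxM rV Hxy Hh).
Qed.

(** Only the representative of the coset [H x] contributes. This is what makes the block matrices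
    multiplicative. *)
Let B_sum x y : \sum_j B x (t j) *m B (t j) y = B x y.
Proof.
have Cx : (H :* x)%g \in rcosets H [set: gT].
  by apply/rcosetsP; exists x; rewrite ?inE.
rewrite (bigD1 (enum_rank_in Cx (H :* x)%g)) //= [X in _ + X]big1 => [|j].
  have := tP (enum_rank_in Cx (H :* x)%g); rewrite enum_rankK_in // addr0.
  set i := enum_rank_in _ _ => /esym/rcoset_eqP/rcosetP[h Hh ->].
  have -> : B x (h * x)%g = rV h^-1%g by rewrite /B invMg mulKVg groupV Hh.
  by rewrite B_left // mulmxA -repr_mxM ?groupV // mulVg repr_mx1 mul1mx.
move=> ne_j; rewrite {1}/B; case: ifP => [Hx | _]; last by rewrite mul0mx.
case/eqP: ne_j; rewrite -{1}(enum_valK_in Cx j) tP; congr enum_rank_in.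
by apply/esym/rcoset_eqP; rewrite mem_rcoset.
Qed.

Let W (g : gT) : 'M[F]_(\sum_(i < k) m) :=
  \mxblock_(i < k, j < k) B (t i * g)%g (t j).

Let W_repr : mx_repr G W.
Proof.
split=> [|x y _ _].
  apply/mxblockP=> i j; rewrite mxblockK mulg1.
  rewrite /B; case: (eqVneq i j) => [<-{j} | ne_ij].
    rewrite mulgV group1 repr_mx1; apply/matrixP=> a b.
    rewrite !mxE -[RHS]/((_ == _ :> nat)%:R).
    by rewrite (@tagnat.eq_Rank _ (fun=> m) i i a b) eqxx.
  rewrite ifF; last first.
    apply/negP=> Hij; case/eqP: ne_ij; apply: enum_val_inj.
    by rewrite !tP; apply/rcoset_eqP; rewrite mem_rcoset.
  by apply/matrixP=> a b; rewrite !mxE -[RHS]/((_ == _ :> nat)%:R);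
  rewrite (@tagnat.eq_Rank _ (fun=> m) i j a b) (negPf ne_ij).
rewrite /W mul_mxblock; apply: eq_mxblock => i l.
by under eq_bigr do rewrite [B (_ * y)%g _]B_shift; rewrite B_sum -B_shift mulgA.
Qed.
Let rW : reprG (\sum_(i < k) m) := MxRepresentation W_repr.

Lemma induced_exists :
  exists n (rI : reprG n) E P, induction_system rV rI E P /\ n = (m * #|G : H|%g)%N.
Proof.
(* The representative of the coset [H] need not be 1; these blocks are the inclusion and projection
   for that coset, corrected by the action of its representative. *)
exists _, rW, (\mxrow_(j < k) B 1%g (t j)), (\mxcol_(i < k) B (t i) 1%g).
have EW g : \mxrow_(j < k) B 1%g (t j) *m W g = \mxrow_(j < k) B g (t j).
  rewrite mul_mxrow_mxblock; apply: eq_mxrow => j.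
  by under eq_bigr do rewrite B_shift; rewrite B_sum -B_shift mul1g.
have WP g : W g *m \mxcol_(i < k) B (t i) 1%g = \mxcol_(i < k) B (t i) g^-1%g.
  rewrite mul_mxblock_mxrow; apply: eq_mxcol => i.
  by rewrite B_sum B_shift mul1g.
split; last by rewrite sum_nat_const card_ord mulnC.
split=> [h Hh | h Hh | g |] /=.
- rewrite EW mul_mxrow; apply: eq_mxrow => j.
  by rewrite -B_left // mulg1.
- rewrite WP mxcol_mul; apply: eq_mxcol => i.
  by rewrite -B_right // mulg1.
- by rewrite EW mul_mxrow_mxcol B_sum /B invg1 mulg1.
transitivity (W 1); last by rewrite -(repr_mx1 rW).
(* Each term of the trace is the idempotent of one coset, and [B_sum] adds them up to the
   identity. *)
transitivity (\sum_(C in rcosets H [set: gT])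
    \mxblock_(i < k, j < k) (B (t i) (repr C) *m B (repr C) (t j))).
  apply: eq_bigr => C _.
  by rewrite mulmxA WP -mulmxA EW invgK mul_mxcol_mxrow.
rewrite -mxblock_sum; apply: eq_mxblock => i l; rewrite mulg1 -B_sum.
by rewrite big_enum_val.
Qed.

End Induced.
End RelativeTrace.

(** * Frobenius reciprocity, direct summands and Fitting's lemma *)

Section Modules.
Variables (F : fieldType) (gT : finGroupType).
Local Notation G := [set: gT]%G.
Local Notation reprG := (mx_representation F G).

(** Frobenius reciprocity: the trace extends the [H]-homomorphism [A] to the induced module. Since
    [E g P] vanishes for [g] outside [H], only the coset [H] contributes after multiplication by
    [E]. *)
Lemma trace_embedding (H : {group gT}) m (rV : mx_representation F H m)
    n (rW : reprG n) E P n' (rX : reprG n') (A : 'M_(m, n')) :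
  induction_system rV rW E P -> hom_of H rV rX A ->
  E *m rel_trace H rW rX (P *m A) = A.
Proof.
case=> homE homP EgP _ homA.
have homPA : hom_of H rW rX (P *m A).
  by move=> h Hh; rewrite mulmxA homP // -!mulmxA homA.
rewrite /rel_trace /coset_sum mulmx_sumr.
rewrite -[LHS]/(coset_sum H (fun g => E *m (rW g^-1%g *m (P *m A) *m rX g))).
rewrite coset_sum_lcoset1 => [|h x Hh|x nHx].
- by rewrite invg1 !mulmxA EgP group1 !repr_mx1 mul1mx mulmx1.
- by rewrite (rel_trace_inv homPA).
by rewrite !mulmxA EgP groupV (negPf nHx) !mul0mx.
Qed.

Lemma induction_system_induced_from (H : {group gT}) m
    (rV : mx_representation F H m) n (rW : reprG n) E P :
  induction_system rV rW E P -> n = (m * #|G : H|%g)%N -> induced_from rV rW.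
Proof.
case=> homE homP EgP trPE def_n.
have freeE : row_free E.
  by apply/row_freeP; exists P; rewrite -[E]mulmx1 -(repr_mx1 rW) EgP group1 repr_mx1.
have eqE : (<<E>> :=: E)%MS by apply: genmxE.
have modU : mxmodule (subg_repr rW (subsetT H)) <<E>>%MS.
  apply/mxmoduleP=> h Hh; rewrite /= (eqmxMr _ eqE) eqE -homE //.
  exact: submxMl.
exists <<E>>%MS; split.
- exists modU; apply: mx_rsim_sym; exists (in_submod _ E).
  + by rewrite eqE (eqP freeE).
  + by rewrite /row_free mxrank_in_submod ?eqE // (eqP freeE).
  move=> h Hh; rewrite -(in_submodJ modU) ?eqE //= -homE //.
  by rewrite [LHS]mulmxA.
- rewrite -sub1mx -trPE; apply: summx_sub => C _.
  apply: (submx_trans _ (sumsmx_sup (repr C) _ (submx_refl _))); rewrite ?inE //.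
  by rewrite (eqmxMr _ eqE) !mulmxA submxMr // submxMl.
by rewrite eqE (eqP freeE).
Qed.

(** By Frobenius reciprocity the embedding of [V] in [W] extends to a homomorphism [T] from the
    standard induced module. It is onto because the translates of [U] span [W], and the dimensions
    agree, so [T] transports the standard system to [W]. *)
Lemma induced_from_system (H : {group gT}) m (rV : mx_representation F H m)
    n (rW : reprG n) :
  induced_from rV rW -> exists E P, induction_system rV rW E P.
Proof.
case=> U [[modU /mx_rsim_sym[B def_m freeB homB]] fullU def_n].
have [n' [rI [E0 [P0 [sysI def_n']]]]] := induced_exists rV.
pose E : 'M_(m, n) := val_submod B.
have homE : hom_of H rV rW E.
  move=> h Hh; transitivity (val_submod (B *m submod_repr modU h)).
    by rewrite -(homB h Hh) /E /val_submod /= mulmxA.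
  exact: (val_submodJ modU).
have sUE : (U <= E)%MS.
  rewrite /E val_submodE eqmxMfull ?val_submod1 //.
  by rewrite /row_full (eqP freeB) def_m.
move: E homE sUE => E homE sUE; pose T := rel_trace H rI rW (P0 *m E).
have homPE : hom_of H rI rW (P0 *m E).
  by case: sysI => _ homP _ _ h Hh; rewrite mulmxA homP // -!mulmxA homE.
have homT : hom_of G rI rW T by apply: rel_trace_hom.
have E0T : E0 *m T = E by apply: trace_embedding sysI homE.
have nn' : n' = n by rewrite def_n' def_m.
have unitT : row_full T.
  rewrite -sub1mx; apply: submx_trans (_ : (\sum_(g in G) U *m rW g)%MS <= _)%MS.
    by rewrite sub1mx.
  apply/sumsmx_subP => g _; apply: submx_trans (submxMr _ sUE) _.
  by rewrite -E0T -mulmxA -homT ?inE // mulmxA submxMl.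
move: {def_n'} nn' => nn'; subst n'.
rewrite row_full_unit in unitT.
have homV : hom_of G rW rI (invmx T).
  move=> g Gg; apply: (canRL (mulKmx unitT)).
  by rewrite mulmxA -homT // mulmxK.
case: (sysI) => homE0 homP0 E0gP0 trI.
exists E, (invmx T *m P0); split=> //.
- by move=> h Hh; rewrite mulmxA homV ?inE // -mulmxA homP0 // mulmxA.
- move=> g; rewrite -E0gP0 -E0T -(mulmxA E0) -homT ?inE // !mulmxA.
  by rewrite mulmxK.
by rewrite -mulmxA -(mul_rel_trace _ _ _ homV) mulVmx.
Qed.

Lemma split_summand m n (rM : reprG m) (rW : reprG n) a b :
  hom_of G rM rW a -> hom_of G rW rM b -> a *m b = 1%:M -> summand rM rW.
Proof.
move=> homa homb ab1.
have modK : mxmodule rW (kermx b).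
  apply/mxmoduleP=> g Gg; apply/sub_kermxP.
  by rewrite -mulmxA homb // mulmxA mulmx_ker mul0mx.
have rb : \rank b = m.
  by apply/eqP; rewrite -/(row_full b); apply/row_fullP; exists a.
have le_mn : (m <= n)%N by rewrite -rb rank_leq_row.
exists (\rank (kermx b)), (submod_repr modK).
exists (col_mx a (val_submod 1%:M)).
- by rewrite mxrank_ker rb subnKC.
- have dimE : (m + \rank (kermx b) = n)%N by rewrite mxrank_ker rb subnKC.
  rewrite /row_free [X in _ == X]dimE -/(row_full _) -sub1mx -addsmxE.
  rewrite -[X in (X <= _)%MS](subrK (b *m a)) addrC addmx_sub_adds ?submxMl //.
  rewrite val_submod1; apply/sub_kermxP.
  by rewrite mulmxBl mul1mx -mulmxA ab1 mulmx1 subrr.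
move=> g Gg; rewrite mul_block_col !mul0mx addr0 add0r mul_col_mx homa //.
by congr col_mx; rewrite -val_submodE -[X in val_submod X]mul1mx val_submodJ.
Qed.

Lemma split_summand_unit m n (rM : reprG m) (rW : reprG n) a b :
  hom_of G rM rW a -> hom_of G rW rM b -> a *m b \in unitmx -> summand rM rW.
Proof.
move=> homa homb uab; apply: (split_summand homa (b := b *m invmx (a *m b))).
  move=> g Gg; rewrite mulmxA homb // -!mulmxA; congr (_ *m _).
  apply: (canRL (mulKmx uab)); rewrite !mulmxA; apply: (canLR (mulmxK uab)).
  by rewrite -!mulmxA -homb // !(mulmxA a) -homa // -!mulmxA.
by rewrite mulmxA mulmxV.
Qed.

Lemma dsum_rsimP m k n (rM : reprG m) (rN : reprG k) (rW : reprG n) :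
  mx_rsim (dsum_repr rM rN) rW ->
  exists a b a' b', [/\ hom_of G rM rW a, hom_of G rW rM b, hom_of G rN rW a' &
    [/\ hom_of G rW rN b', a *m b = 1%:M, a' *m b' = 1%:M &
        b *m a + b' *m a' = 1%:M]].
Proof.
case=> B def_n freeB homB; subst n; rewrite row_free_unit in freeB.
have homV : hom_of G rW (dsum_repr rM rN) (invmx B).
  move=> g Gg; apply: (canRL (mulKmx freeB)).
  by rewrite mulmxA -homB // mulmxK.
exists (usubmx B), (lsubmx (invmx B)), (dsubmx B), (rsubmx (invmx B)).
have BV : col_mx (usubmx B) (dsubmx B) *m
    row_mx (lsubmx (invmx B)) (rsubmx (invmx B)) = 1%:M.
  by rewrite vsubmxK hsubmxK mulmxV.
have VB : row_mx (lsubmx (invmx B)) (rsubmx (invmx B)) *m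
    col_mx (usubmx B) (dsubmx B) = 1%:M.
  by rewrite vsubmxK hsubmxK mulVmx.
rewrite mul_col_row scalar_mx_block in BV; rewrite mul_row_col in VB.
case/eq_block_mx: BV => e1 _ _ e2.
have hom1 g : g \in G -> rM g *m usubmx B = usubmx B *m rW g /\
    rN g *m dsubmx B = dsubmx B *m rW g.
  move=> Gg; have := homB g Gg; rewrite -[X in _ *m X]vsubmxK
    -[X in _ = X *m _]vsubmxK mul_block_col.
  by rewrite !mul0mx addr0 add0r mul_col_mx => /eq_col_mx.
have hom2 g : g \in G -> rW g *m lsubmx (invmx B) = lsubmx (invmx B) *m rM g /\
    rW g *m rsubmx (invmx B) = rsubmx (invmx B) *m rN g.
  move=> Gg; have := homV g Gg; rewrite -[X in _ *m X]hsubmxK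
    -[X in _ = X *m _]hsubmxK mul_row_block.
  by rewrite !mulmx0 addr0 add0r mul_mx_row => /eq_row_mx.
by split; [move=> g /hom1[] | move=> g /hom2[] | move=> g /hom1[] | split=> //
  g /hom2[]].
Qed.

Lemma summandP m n (rM : reprG m) (rW : reprG n) :
  summand rM rW ->
  exists a b, [/\ hom_of G rM rW a, hom_of G rW rM b & a *m b = 1%:M].
Proof.
by case=> k [rN /dsum_rsimP[a [b [a' [b' [? ? _ [_ ? _ _]]]]]]]; exists a, b.
Qed.

Lemma hom_comp m n k (r1 : reprG m) (r2 : reprG n) (r3 : reprG k) A B :
  hom_of G r1 r2 A -> hom_of G r2 r3 B -> hom_of G r1 r3 (A *m B).
Proof. by move=> hA hB g Gg; rewrite mulmxA hA // -!mulmxA hB. Qed.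

Lemma summand_trans m n k (r1 : reprG m) (r2 : reprG n) (r3 : reprG k) :
  summand r1 r2 -> summand r2 r3 -> summand r1 r3.
Proof.
move=> /summandP[a [b [ha hb ab]]] /summandP[c [e [hc he ce]]].
apply: (split_summand (hom_comp ha hc) (hom_comp he hb)).
by rewrite -mulmxA (mulmxA c) ce mul1mx.
Qed.

Lemma summand_refl m (r : reprG m) : summand r r.
Proof.
by apply: (@split_summand _ _ _ _ 1%:M 1%:M) => [g _|g _|]; rewrite ?mulmx1 ?mul1mx.
Qed.

(** The module is the direct sum of the kernel and the image of a power [A] of [T] whose square has
    the same rank. The image is nonzero as [T] is not nilpotent, so by indecomposability the kernel
    is 0. *)
Lemma fitting m (r : reprG m) (T : 'M_m) :
  indecomposable r -> hom_of G r r T -> (forall k, T ^+ k != 0) -> T \in unitmx.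
Proof.
case=> m_gt0 indec homT nnilT.
have homX k : hom_of G r r (T ^+ k).
  elim: k => [|k IHk]; first by move=> g _; rewrite expr0 mulmx1 mul1mx.
  by rewrite exprSr; apply: hom_comp IHk homT.
(* The exponent [k.+1] excludes the power 0, for which the ranks agree trivially. The search ends
   because each squaring that changes the rank lowers it. *)
have [k rkE] : exists k, \rank (T ^+ k.+1 *m T ^+ k.+1) = \rank (T ^+ k.+1).
  have [r0 le_r0] : exists r0, (\rank (T ^+ 0%N.+1) <= r0)%N by exists m; apply: rank_leq_row.
  elim: r0 0%N le_r0 => [|r0 IHr] k le_r.
    by exists k; apply/eqP; rewrite eqn_leq mxrankM_maxl (leq_trans le_r).
  have [eq_rk | ne_rk] := eqVneq (\rank (T ^+ k.+1 *m T ^+ k.+1)) (\rank (T ^+ k.+1)).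
    by exists k.
  apply: (IHr (k + k.+1)%N); rewrite -addSn exprD -mulmxE -ltnS.
  by apply: leq_trans le_r; rewrite ltn_neqAle ne_rk mxrankM_maxl.
pose A := T ^+ k.+1; have homA : hom_of G r r A := homX k.+1.
have modK : mxmodule r (kermx A).
  apply/mxmoduleP=> g Gg; apply/sub_kermxP.
  by rewrite -mulmxA homA // mulmxA mulmx_ker mul0mx.
have modA : mxmodule r A.
  by apply/mxmoduleP=> g Gg; rewrite -homA // submxMl.
have capKA : (kermx A :&: A = 0)%MS.
  apply/eqP; rewrite -mxrank_eq0 capmxC; have := mxrank_mul_ker A A.
  by rewrite rkE -[RHS]addn0 => /addnI ->.
have dimKA : (\rank (kermx A) + \rank A = m)%N.
  by rewrite mxrank_ker subnK ?rank_leq_row.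
have simKA : mx_rsim (dsum_repr (submod_repr modK) (submod_repr modA)) r.
  exists (col_mx (val_submod 1%:M) (val_submod 1%:M)) => //.
    rewrite /row_free -addsmxE (adds_eqmx (val_submod1 _) (val_submod1 _)).
    by rewrite mxrank_disjoint_sum.
  move=> g Gg; rewrite mul_block_col !mul0mx addr0 add0r mul_col_mx.
  by congr col_mx; rewrite -val_submodE -[X in val_submod X]mul1mx val_submodJ.
case: (indec _ _ _ _ simKA) => [rK0 | rA0]; last first.
  by case/eqP: (nnilT k.+1); apply/eqP; rewrite -mxrank_eq0 -/A rA0.
rewrite -row_free_unit -kermx_eq0 -mxrank_eq0 -leqn0 -rK0.
by apply: mxrankS; apply/sub_kermxP; rewrite /A exprS -mulmxE mulmxA mulmx_ker mul0mx.
Qed.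

End Modules.

(** * A criterion for vertices and sources *)

Section Vertices.
Variables (F : fieldType) (gT : finGroupType) (p : nat).
Hypothesis chp : p \in [pchar F].
Local Notation G := [set: gT]%G.
Local Notation reprG := (mx_representation F G).

(** A form of Higman's criterion: the traces of [A E] and [P B] map [Y] to the induced module and
    back, and their composite is the trace of [A B]. *)
Lemma rel_trace_summand (Q : {group gT}) m (rY : reprG m) k
    (rV : mx_representation F Q k) A B :
  hom_of Q rY rV A -> hom_of Q rV rY B ->
  rel_trace Q rY rY (A *m B) \in unitmx -> summand_of_induced rY rV.
Proof.
move=> homA homB unitAB.
have [n [rI [E [P [sysI def_n]]]]] := induced_exists rV.
exists n, rI; split; first exact: induction_system_induced_from sysI def_n.
have [homE homP _ _] := sysI.
have homPB : hom_of Q rI rY (P *m B).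
  by move=> q Qq; rewrite mulmxA homP // -!mulmxA homB.
have homAE : hom_of Q rY rI (A *m E).
  by move=> q Qq; rewrite mulmxA homA // -!mulmxA homE.
have homb := rel_trace_hom homPB.
apply: (split_summand_unit (rel_trace_hom homAE) homb).
by rewrite (rel_trace_mul _ _ _ homb) -mulmxA (trace_embedding sysI homB).
Qed.

(* The summands of [v f] indexed by the cosets [H g] form a function constant
   on Q-orbits, so that modulo p only the Q-fixed cosets contribute. *)
Lemma pairing_eq0 (H Q : {group gT}) n (rW : reprG n) X v f :
    (p.-group Q)%g -> hom_of H rW rW X -> rel_trace H rW rW X = 1%:M ->
    (forall q, q \in Q -> v *m rW q = v) ->
    (forall q, q \in Q -> rW q *m f = f) ->
    (forall g, Q \subset H :^ g -> v *m rW g^-1%g *m X = 0)%g ->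
  v *m f = 0 :> 'M_1.
Proof.
move=> pQ homX trX1 vQ fQ vX0.
rewrite -[v]mulmx1 -trX1 /rel_trace /coset_sum mulmx_sumr mulmx_suml.
apply/matrixP=> i j; rewrite summxE mxE.
pose t g := (v *m (rW g^-1%g *m X *m rW g) *m f) i j.
rewrite -[LHS]/(coset_sum H t).
apply: (coset_sum_pgroup0 chp pQ) => [h x Hh | q x Qq | x Qx].
- by rewrite /t (rel_trace_inv homX).
- rewrite /t invMg !reprGM !mulmxA vQ ?groupV // -!mulmxA fQ //.
by rewrite /t !mulmxA vX0 // !mul0mx mxE.
Qed.

(** The case of [induction_system] for a linear character [s]: [u] spans the summand of the coset
    [H], and [phi] reads off the coordinate on it. *)
Definition linear_system (H : {group gT}) (s : gT -> F) n (rW : reprG n)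
    (u : 'rV_n) (phi : 'cV_n) : Prop :=
  [/\ forall h, h \in H -> u *m rW h = s h *: u,
      forall h, h \in H -> rW h *m phi = s h *: phi,
      forall g, u *m rW g *m phi = (if g \in H then s g else 0)%:M
    & rel_trace H rW rW (phi *m u) = 1%:M].

(** The vector [u y] spans the summand of the coset [H y], whose stabilizer is [H^y]. *)
Lemma linear_system_conj (H : {group gT}) s n (rW : reprG n) u phi y :
  linear_system H s rW u phi ->
  linear_system (H :^ y) (fun x => s (x ^ y^-1)%g) rW (u *m rW y)
    (rW y^-1%g *m phi).
Proof.
case=> uH phiH uphi tr1.
have yJ x : (y * x = x ^ y^-1 * y)%g by rewrite /conjg invgK !mulgA mulgKV.
split=> [h | h | g |].
- rewrite mem_conjg => Hh; rewrite -mulmxA -reprGM yJ reprGM mulmxA uH //.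
  by rewrite scalemxAl.
- rewrite mem_conjg => Hh; rewrite mulmxA -reprGM.
  have -> : (h * y^-1 = y^-1 * h ^ y^-1)%g by rewrite /conjg invgK !mulgA mulVg mul1g.
  by rewrite reprGM -mulmxA phiH // scalemxAr.
- by rewrite mem_conjg mulmxA -(mulmxA u) -reprGM -(mulmxA u) -reprGM yJ mulgK uphi.
rewrite -[RHS]tr1 /rel_trace /coset_sum.
have hom1 : hom_of H rW rW (phi *m u).
  by move=> h Hh; rewrite mulmxA phiH // -[RHS]mulmxA uH // -scalemxAl -scalemxAr.
rewrite (reindex (fun D : {set gT} => y^-1 *: D)%g) /=; last first.
  apply: onW_bij; exists (fun D : {set gT} => y *: D)%g => D.
    by rewrite lcosetKV.
  by rewrite lcosetK.
have memE D : ((y^-1 *: D)%g \in rcosets (H :^ y) [set: gT]) = (D \in rcosets H [set: gT]).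
  have cosJ x : (H :^ y :* x = y^-1 *: (H :* (y * x)))%g.
    by rewrite conjsgE rcosetM -!mulgA.
  apply/rcosetsP/rcosetsP=> [] [x _ defD].
    by exists (y * x)%g; rewrite ?inE // -[D](lcosetK y^-1%g) defD cosJ lcosetK.
  by exists (y^-1 * x)%g; rewrite ?inE // defD cosJ mulKVg.
apply: eq_big => // D; rewrite memE => DH.
have Dr : (y * repr (y^-1 *: D))%g \in D.
  have : (y * repr (y^-1 *: D) \in y *: (y^-1 *: D))%g.
    by rewrite mem_lcoset mulKg (@repr_rcosets _ (H :^ y)) ?memE.
  by rewrite lcosetKV.
have := coset_invP (fun h x Hh => rel_trace_inv hom1 x Hh) DH Dr => /= ->.
by rewrite invMg !reprGM !mulmxA.
Qed.

Lemma induced_linear_system (H : {group gT}) (rV : mx_representation F H 1)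
    n (rW : reprG n) :
  induced_from rV rW ->
  exists u phi, linear_system H (fun g => rV g 0 0) rW u phi.
Proof.
case/induced_from_system=> u [phi [uH phiH uphi tr1]]; exists u, phi; split=> //.
- by move=> h Hh; rewrite -uH // [rV h]mx11_scalar mul_scalar_mx mxE mulr1n.
- by move=> h Hh; rewrite phiH // [rV h]mx11_scalar mul_mx_scalar mxE mulr1n.
by move=> g; rewrite uphi; case: ifP => _; rewrite ?raddf0 -?mx11_scalar.
Qed.

(** * Detecting modules by a pairing *)

Section Detect.
Variables (Q L : {group gT}) (chi : gT -> F).

(* The Brauer quotient V(Q) of a p-permutation module V is the image of the Q-fixed
   points in the Q-coinvariants, so it can be replaced by the pairing of Q-fixed vectors
   with Q-invariant functionals. *)
Definition undetected n (r : reprG n) : Prop :=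
  forall (v : 'rV_n) (f : 'cV_n),
    (forall l, l \in L -> v *m r l = chi l *: v) ->
    (forall q, q \in Q -> r q *m f = f) -> v *m f = 0.

(** An element [h] of [L] and [H^g] multiplies the number [v g^-1 phi] by [chi h] when absorbed by
    [v], and by [s (h ^ g^-1)] when absorbed by [phi]. So a [Q]-fixed coset [H g] contributes 0
    unless the two characters agree there. *)
Lemma linear_pairing_eq0 (H : {group gT}) s n (rW : reprG n) u phi (v : 'rV_n) (f : 'cV_n) :
    (p.-group Q)%g -> Q \subset L -> {in Q, forall q, chi q = 1} ->
    linear_system H s rW u phi ->
    (forall l, l \in L -> v *m rW l = chi l *: v) ->
    (forall q, q \in Q -> rW q *m f = f) ->
    (forall g, (Q \subset H :^ g)%g ->
       {in (L :&: H :^ g)%g, forall h, s (h ^ g^-1)%g = chi h} ->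
     v *m rW g^-1%g *m phi = 0) ->
  v *m f = 0.
Proof.
move=> pQ sQL chiQ [uH phiH uphi tr1] vL fQ v0.
have homX : hom_of H rW rW (phi *m u).
  by move=> h Hh; rewrite mulmxA phiH // -[RHS]mulmxA uH // -scalemxAl -scalemxAr.
apply: (pairing_eq0 pQ homX tr1) => // [q Qq | g Qg].
  by rewrite vL ?(subsetP sQL) // chiQ // scale1r.
rewrite mulmxA; suff -> : v *m rW g^-1%g *m phi = 0 by rewrite mul0mx.
have [all_h | ] := boolP [forall h in (L :&: H :^ g)%g, s (h ^ g^-1)%g == chi h].
  by apply: v0 => // h Hh; apply/eqP/(forall_inP all_h).
rewrite negb_forall_in => /exists_inP[h]; rewrite inE => /andP[Lh].
rewrite mem_conjg => Hh ne_h.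
have : (chi h - s (h ^ g^-1)%g) *: (v *m rW g^-1%g *m phi) = 0.
  rewrite scalerBl scalemxAl scalemxAl -vL // scalemxAr -phiH //.
  rewrite -!mulmxA !(mulmxA (rW _)) -!reprGM.
  by rewrite /conjg invgK mulKg subrr.
by move/eqP; rewrite scaler_eq0 subr_eq0 eq_sym (negPf ne_h) => /eqP.
Qed.

Lemma undetected_hom m n (rM : reprG m) (rW : reprG n) a b (v : 'rV_m) (f : 'cV_m) :
    undetected rW -> hom_of G rM rW a -> hom_of G rW rM b ->
    (forall l, l \in L -> v *m rM l = chi l *: v) ->
    (forall q, q \in Q -> rM q *m f = f) ->
  v *m a *m b *m f = 0.
Proof.
move=> undetW homa homb vL fQ; rewrite -mulmxA; apply: undetW => [l Ll | q Qq].
  by rewrite -mulmxA -homa ?inE // mulmxA vL // scalemxAl.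
by rewrite mulmxA homb ?inE // -mulmxA fQ.
Qed.

Lemma undetected_summand m n (rM : reprG m) (rW : reprG n) :
  summand rM rW -> undetected rW -> undetected rM.
Proof.
case/summandP=> a [b [homa homb ab1]] undetW v f vL fQ.
by rewrite -[v]mulmx1 -ab1 mulmxA (undetected_hom undetW homa homb).
Qed.

(** Induction on the dimension replaces a full decomposition: if [v f] were nonzero, a splitting of
    [r] into two nonzero parts would have a detected part, against the induction hypothesis; so [r]
    itself would be indecomposable. *)
Lemma undetected_of_indecomposable n (r : reprG n) :
  (forall m (rX : reprG m), indecomposable rX -> summand rX r -> undetected rX) ->
  undetected r.
Proof.
have [k le_nk] : exists k, (n <= k)%N by exists n.
elim: k n le_nk r => [|k IHk] n le_nk r undetX v f vL fQ.
  move: v f {r undetX vL fQ}; move: le_nk; rewrite leqn0 => /eqP-> v f.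
  by rewrite thinmx0 mul0mx.
apply/eqP; apply: contraT => vf_n0.
have n_gt0 : (0 < n)%N.
  rewrite lt0n; apply: contraNneq vf_n0 => n0.
  by move: v f {r undetX vL fQ IHk le_nk}; rewrite n0 => v f; rewrite thinmx0 mul0mx.
case/negP: (vf_n0); apply/eqP; apply: (undetX _ r) => //; last exact: summand_refl.
split=> // m1 m2 r1 r2 sim12.
have [[-> | m1_gt0] [-> | m2_gt0]] := (posnP m1, posnP m2); [by left|by left|by right|].
have [a [b [a' [b' [ha hb ha' [hb' ab ab' sum1]]]]]] := dsum_rsimP sim12.
have def_n := mxrank_rsim sim12.
have s1 : summand r1 r := split_summand ha hb ab.
have s2 : summand r2 r := split_summand ha' hb' ab'.
have d1 : undetected r1.
  apply: IHk => [|m rX iX sX]; last by apply: undetX => //; apply: summand_trans s1.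
  by rewrite -ltnS (leq_trans _ le_nk) // -def_n -addn1 leq_add2l.
have d2 : undetected r2.
  apply: IHk => [|m rX iX sX]; last by apply: undetX => //; apply: summand_trans s2.
  by rewrite -ltnS (leq_trans _ le_nk) // -def_n -add1n leq_add2r.
exfalso; case/eqP: vf_n0.
rewrite -[v]mulmx1 -sum1 mulmxDr mulmxDl !mulmxA.
by rewrite (undetected_hom d1 hb ha) // (undetected_hom d2 hb' ha') // addr0.
Qed.

End Detect.
End Vertices.

(** * The criterion for an abstract group, with its reversing element [sigma] *)

Section Criterion.
Variables (F : fieldType) (gT : finGroupType) (p : nat).
Hypothesis chp : p \in [pchar F].
Local Notation G := [set: gT]%G.
Local Notation reprG := (mx_representation F G).
Variables (Q L H : {group gT}) (chi s : gT -> F) (sigma : gT).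
Hypotheses (pQ : (p.-group Q)%g) (sQL : Q \subset L).
Hypotheses (chiM : {in L &, forall x y, chi (x * y)%g = chi x * chi y}).
Hypothesis chi2 : {in L, forall x, chi x * chi x = 1}.
Hypothesis chiQ : {in Q, forall q, chi q = 1}.
Hypotheses (sQH : Q \subset H) (s2 : {in H, forall x, s x * s x = 1}).
Hypothesis s_chi : {in H :&: L, s =1 chi}.
Hypothesis Ls : sigma \in L.
Local Notation E := (H :&: H :^ sigma^-1)%G.
Hypothesis sylQ : (p.-Sylow(E) Q)%g.
Hypothesis s_sigma : {in E, forall h, s (h ^ sigma)%g = s h}.
(* If the coset H sigma h meets L, then it is H sigma. *)
Hypothesis cosets_sigma : forall h l, h \in H -> l \in L ->
  (l * (sigma * h)^-1 \in H -> l * sigma^-1 \in H)%g.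
(** Every coset that can contribute to a pairing in [M] has a representative in [L]. *)
Hypothesis cosets_L : forall g, (Q \subset H :^ g)%g ->
  {in (L :&: H :^ g)%g, forall h, s (h ^ g^-1)%g = chi h} ->
  exists2 l, l \in L & (g * l^-1 \in H)%g.

Variables (n : nat) (rM : reprG n) (u : 'rV[F]_n) (phi : 'cV[F]_n).
Hypothesis sysM : linear_system H s rM u phi.

Let s1 : s 1%g = 1.
Proof.
have [_ _ uphi _] := sysM; have := uphi 1%g; rewrite group1 => e1.
have [_ phiH _ _] := sysM; have := phiH 1%g (group1 H).
rewrite repr_mx1 mul1mx => e2; rewrite repr_mx1 mulmx1 in e1.
have : u *m phi = u *m (s 1%g *: phi) by rewrite -e2.
rewrite -scalemxAr e1 => /matrixP/(_ 0 0); rewrite !mxE eqxx mulr1n => e3.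
have s1_n0 : s 1%g != 0.
  by apply/eqP=> s10; have := s2 (group1 H); rewrite s10 mul0r => /eqP;
     rewrite eq_sym oner_eq0.
by apply: (mulIf s1_n0); rewrite mul1r -e3.
Qed.

Let chi1 : chi 1%g = 1. Proof. by rewrite chiQ. Qed.

Let chiV : {in L, forall x, chi x^-1%g = chi x}.
Proof.
move=> x Lx; apply: (mulIf (_ : chi x != 0)).
  by apply/eqP=> x0; have := chi2 Lx; rewrite x0 mul0r => /eqP; rewrite eq_sym oner_eq0.
by rewrite -chiM ?groupV // mulVg chi1 chi2.
Qed.

Let sV : {in H, forall x, s x^-1%g = s x}.
Proof.
move=> x Hx; have [_ phiH uphi _] := sysM.
have := uphi (x * x^-1)%g; rewrite mulgV group1 s1 -(mulgV x) reprGM.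
rewrite -!mulmxA phiH ?groupV // -!scalemxAr mulmxA uphi Hx.
move/matrixP/(_ 0 0); rewrite !mxE eqxx !mulr1n => e.
apply: (mulIf (_ : s x != 0)); last by rewrite s2.
by apply/eqP=> x0; have := s2 Hx; rewrite x0 mul0r => /eqP; rewrite eq_sym oner_eq0.
Qed.

(** The analogue of a polytabloid: [chi l] times [u l], summed over the cosets of [H :&: L] in [L].
    As [coset_sum] runs over the whole group, the terms outside [L] are set to 0. *)
Let w0 : 'rV[F]_n :=
  coset_sum (H :&: L) (fun g => if g \in L then chi g *: (u *m rM g) else 0).

Let w0_inv h g : h \in (H :&: L)%G ->
  (if (h * g)%g \in L then chi (h * g)%g *: (u *m rM (h * g)%g) else 0) =
  (if g \in L then chi g *: (u *m rM g) else 0).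
Proof.
rewrite inE => /andP[Hh Lh]; rewrite groupMl //; case: ifP => // Lg.
have [uH _ _ _] := sysM.
rewrite chiM // reprGM mulmxA uH // -scalemxAl scalerA s_chi ?inE ?Hh //.
by rewrite mulrAC chi2 // mul1r.
Qed.

Let w0L l : l \in L -> w0 *m rM l = chi l *: w0.
Proof.
move=> Ll; rewrite -[w0 in RHS](coset_sum_shift l w0_inv) /w0 /coset_sum.
rewrite mulmx_suml scaler_sumr; apply: eq_bigr => C _.
rewrite groupMr //; case: ifP => Lr; last by rewrite mul0mx scaler0.
by rewrite scalerA chiM // mulrCA chi2 // mulr1 -scalemxAl -mulmxA -reprGM.
Qed.

Let w0phi : w0 *m phi = 1%:M.
Proof.
have [uH _ uphi _] := sysM.
pose t g := (if g \in L then chi g *: (u *m rM g) else 0) *m phi.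
rewrite /w0 /coset_sum mulmx_suml -[LHS]/(coset_sum (H :&: L) t).
rewrite coset_sum_lcoset1 /t => [|h g Hh|g].
- by rewrite group1 chi1 scale1r uphi group1 s1.
- by rewrite w0_inv.
rewrite inE negb_and; case: ifP => Lg; last by rewrite mul0mx.
by rewrite orbF -scalemxAl uphi => /negPf->; rewrite raddf0 scaler0.
Qed.

Let phiQ q : q \in Q -> rM q *m phi = phi.
Proof.
have [_ phiH _ _] := sysM; move=> Qq; rewrite phiH ?(subsetP sQH) //.
by rewrite s_chi ?inE ?(subsetP sQH) ?(subsetP sQL) // chiQ // scale1r.
Qed.

(** A contributing coset is [H l] with [l] in [L], and its term is a multiple of [v phi]. Hence the
    pairing on [M] has rank at most one. *)
Let pairing_phi (v : 'rV_n) (f : 'cV_n) :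
  (forall l, l \in L -> v *m rM l = chi l *: v) ->
  (forall q, q \in Q -> rM q *m f = f) -> v *m phi = 0 -> v *m f = 0.
Proof.
move=> vL fQ vphi0; have [uH phiH uphi tr1] := sysM.
apply: (linear_pairing_eq0 chp pQ sQL chiQ sysM vL fQ) => g Qg all_h.
have [l Ll Hgl] := cosets_L Qg all_h.
have -> : (g^-1 = l^-1 * (g * l^-1)^-1)%g by rewrite -invMg mulgKV.
rewrite reprGM mulmxA vL ?groupV // -!scalemxAl -mulmxA phiH ?groupV //.
by rewrite -scalemxAr vphi0 !scaler0.
Qed.

Let v1 : 'rV_n := u *m rM sigma^-1%g.

Let sQE : Q \subset E. Proof. exact: pHall_sub sylQ. Qed.

(** [sigma] conjugates [Q] into [H], so [Q] fixes both [phi] and [v1], and their product factors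
    through the trivial [Q]-module. *)
Let homQ : hom_of Q rM rM (phi *m v1).
Proof.
move=> q Qq; rewrite mulmxA phiQ // -mulmxA; congr (_ *m _); rewrite /v1.
have [uH _ _ _] := sysM.
have Eq := subsetP sQE q Qq.
have /andP[Hq] : (q \in H) && (q ^ sigma \in H)%g.
  by move: Eq; rewrite !inE mem_conjg invgK.
move=> Hqs; rewrite -mulmxA -reprGM.
have -> : (sigma^-1 * q = q ^ sigma * sigma^-1)%g by rewrite /conjg !mulgA mulgK.
rewrite reprGM mulmxA (uH _ Hqs) s_sigma // s_chi ?inE ?Hq ?(subsetP sQL) //.
by rewrite chiQ // scale1r.
Qed.

Let theta := rel_trace Q rM rM (phi *m v1).
Let c := #|E : Q|%g%:R * chi sigma.

Let c_neq0 : c != 0.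
Proof.
rewrite mulf_eq0 negb_or; apply/andP; split; last first.
  by apply/eqP=> x0; have := chi2 Ls; rewrite x0 mul0r => /eqP; rewrite eq_sym oner_eq0.
rewrite -(dvdn_pcharf chp) -prime_coprime ?(pcharf_prime chp) //.
case/and3P: sylQ => _ _; rewrite p'natE ?(pcharf_prime chp) //.
by rewrite -prime_coprime ?(pcharf_prime chp).
Qed.

(** The term at [g] is the product of [w0 g^-1 phi] and [u sigma^-1 g phi]. The second factor
    requires [sigma^-1 g] in [H]; then the first vanishes unless [g sigma^-1] lies in [E], where the
    signs from [H] cancel and [chi sigma] remains. *)
Let w0theta : w0 *m theta *m phi = c%:M.
Proof.
have [uH phiH uphi tr1] := sysM.
pose t g := if (g * sigma^-1)%g \in E then chi sigma else 0.
have tE g : (w0 *m (rM g^-1%g *m (phi *m v1) *m rM g) *m phi) = (t g)%:M.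
  transitivity ((w0 *m rM g^-1%g *m phi) *m (u *m rM (sigma^-1 * g)%g *m phi)).
    by rewrite reprGM /v1 !mulmxA.
  rewrite uphi.
  rewrite /t; case: ifP => [Hsg | nHsg]; last first.
    rewrite raddf0 mulmx0 ifF ?raddf0 //; apply: contraFF nHsg.
    by rewrite inE mem_conjg invgK /conjg !mulgA mulgKV => /andP[].
  rewrite mul_mx_scalar.
  case: ifP => [Eg | nEg].
    have Hg : (g * sigma^-1 \in H)%g by move: Eg; rewrite inE => /andP[].
    have -> : (g^-1 = sigma^-1 * (g * sigma^-1)^-1)%g by rewrite -invMg mulgKV.
    rewrite reprGM mulmxA w0L ?groupV // -scalemxAl -scalemxAl -mulmxA.
    rewrite phiH ?groupV // -scalemxAr w0phi.
    have -> : (sigma^-1 * g = (g * sigma^-1) ^ sigma)%g by rewrite /conjg mulgKV.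
    rewrite s_sigma // sV // chiV // !scalerA mulrAC s2 // mul1r.
    by rewrite scalemx1.
  suff -> : w0 *m rM g^-1%g *m phi = 0 by rewrite scaler0 raddf0.
  rewrite /w0 /coset_sum !mulmx_suml big1 // => C _.
  case: ifP => Lr; last by rewrite !mul0mx.
  rewrite -!scalemxAl -(mulmxA u) -reprGM uphi; case: ifP => [Hr | _]; last first.
    by rewrite raddf0 scaler0.
  (* The representative [l] of [C] lies in [L] and [l g^-1] in [H]. By [cosets_sigma], [l sigma^-1]
     and hence [g sigma^-1] lie in [H], which puts [g sigma^-1] in [E]. *)
  case/negP: nEg.
  have Hrs : (repr C * sigma^-1 \in H)%g.
    by apply: (cosets_sigma Hsg) => //; rewrite mulKVg.
  rewrite inE mem_conjg invgK /conjg mulgKV Hsg andbT.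
  have -> : (g * sigma^-1 = (repr C * g^-1)^-1 * (repr C * sigma^-1))%g.
    by rewrite invMg invgK -mulgA mulKg.
  by rewrite groupM ?groupV.
rewrite /theta /rel_trace /coset_sum mulmx_sumr mulmx_suml.
transitivity ((coset_sum Q t)%:M : 'M[F]_1).
  by rewrite (eq_bigr _ (fun C _ => tE (repr C))) -raddf_sum.
have tQ q x : q \in Q -> t (q * x)%g = t x.
  by move=> Qq; rewrite /t -mulgA (groupMl _ (subsetP sQE q Qq)).
(* Translation by [sigma] turns the condition into [g] in [E], which holds on [[E : Q]] cosets of
   [Q]. *)
rewrite -(coset_sum_shift sigma tQ) /coset_sum /t; congr (_%:M).
rewrite (eq_bigr (fun C => if repr C \in E then chi sigma else 0)); last first.
  by move=> C _; rewrite mulgK.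
rewrite -big_mkcondr /= sumr_const /c mulr_natl; congr (_ *+ _).
apply: eq_card => C; rewrite unfold_in; apply/andP/rcosetsP=> [[CQ Er] | [x Ex ->]].
  by exists (repr C) => //; apply: rcosetsE CQ (repr_rcosets CQ).
split; first by apply/rcosetsP; exists x; rewrite ?inE.
by case/rcosetP: (mem_repr_rcoset Q x) => q Qq ->; rewrite (groupM (subsetP sQE q Qq)).
Qed.

(** Subtracting from [v] the multiple of [w0] with the same value on [phi] leaves a vector that also
    kills [theta *m phi], by [pairing_phi]. *)
Let theta_phi (v : 'rV_n) : (forall l, l \in L -> v *m rM l = chi l *: v) ->
  v *m theta *m phi = c *: (v *m phi).
Proof.
move=> vL; have homT := rel_trace_hom homQ.
pose a := (v *m phi) 0 0.
have va : v *m phi = a%:M by rewrite -mx11_scalar.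
have : (v - a *: w0) *m (theta *m phi) = 0.
  apply: pairing_phi => [l Ll | q Qq |].
  - by rewrite mulmxBl vL // -scalemxAl w0L // scalerBr !scalerA mulrC.
  - by rewrite mulmxA homT ?inE // -mulmxA phiQ.
  by rewrite mulmxBl -scalemxAl w0phi va scalemx1 subrr.
rewrite mulmxBl => /eqP; rewrite subr_eq0 => /eqP; rewrite mulmxA => ->.
by rewrite va -scalemxAl mulmxA w0theta !scale_scalar_mx mulrC.
Qed.

Theorem vertex_trivial_source m (rY : reprG m) k (rN : reprG k) :
    indecomposable rY -> mx_rsim (dsum_repr rY rN) rM -> undetected Q L chi rN ->
  vertex rY Q /\ trivial_source_at rY Q.
Proof.
move=> indY /dsum_rsimP[a [b [a' [b' [homa homb homa' [homb' ab _ sum1]]]]]] undetN.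
have homT := rel_trace_hom homQ.
have wL l : l \in L -> (w0 *m b) *m rY l = chi l *: (w0 *m b).
  by move=> Ll; rewrite -mulmxA -homb ?inE // mulmxA w0L // scalemxAl.
have phi_aQ q : q \in Q -> rY q *m (a *m phi) = a *m phi.
  by move=> Qq; rewrite mulmxA homa ?inE // -mulmxA phiQ.
(* The complement is undetected, so projecting [v] to [Y] does not change its value on [phi]. *)
have projY (v : 'rV_n) : (forall l, l \in L -> v *m rM l = chi l *: v) ->
    v *m b *m a *m phi = v *m phi.
  move=> vL; rewrite -[v in RHS]mulmx1 -sum1 mulmxDr mulmxDl !mulmxA.
  by rewrite (undetected_hom undetN homb' homa') ?addr0.
have wphi : w0 *m b *m a *m phi = 1%:M by rewrite projY ?w0phi //; apply: w0L.
pose T := a *m theta *m b.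
have homTY : hom_of G rY rY T := hom_comp (hom_comp homa homT) homb.
(* [T] scales the pairing with [a *m phi] by [c]. Since [w0 *m b] pairs to 1 and [c] is nonzero, no
   power of [T] vanishes. *)
have TL (v : 'rV_m) j : (forall l, l \in L -> v *m rY l = chi l *: v) ->
    (forall l, l \in L -> v *m T ^+ j *m rY l = chi l *: (v *m T ^+ j)) /\
    v *m T ^+ j *m a *m phi = c ^+ j *: (v *m a *m phi).
  move=> vL; elim: j => [|j [IHL IHc]]; first by rewrite !expr0 mulmx1 scale1r.
  have vaL l : l \in L -> v *m T ^+ j *m a *m rM l = chi l *: (v *m T ^+ j *m a).
    by move=> Ll; rewrite -[LHS]mulmxA -homa ?inE // mulmxA IHL // -scalemxAl.
  split=> [l Ll|].
    by rewrite exprSr -mulmxE mulmxA -[LHS]mulmxA -homTY ?inE // mulmxA IHL // -scalemxAl.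
  rewrite exprSr -mulmxE mulmxA {2}/T !mulmxA projY ?theta_phi //.
    by rewrite IHc scalerA exprS.
  by move=> l Ll; rewrite -[LHS]mulmxA -homT ?inE // mulmxA vaL // -scalemxAl.
have unitT : T \in unitmx.
  apply: (fitting indY homTY) => j; apply/eqP=> T0.
  have [_] := TL _ j wL; rewrite T0 mulmx0 !mul0mx wphi scalemx1.
  move/matrixP/(_ 0 0)/eqP; rewrite !mxE eqxx mulr1n eq_sym expf_eq0.
  by rewrite (negPf c_neq0) andbF.
(* This trace from [Q] passes through the trivial module, so it yields both the relative
   projectivity and the source. *)
have trT : rel_trace Q rY rY (a *m phi *m (v1 *m b)) = T.
  rewrite /T (mul_rel_trace _ _ _ homa) (rel_trace_mul _ _ _ homb).
  by rewrite !mulmxA.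
have v1Q q : q \in Q -> v1 *m b *m rY q = v1 *m b.
  move=> Qq; rewrite -mulmxA -homb ?inE // mulmxA; congr (_ *m _).
  have [_ _ uphi _] := sysM.
  have := congr1 (fun X => u *m X) (homQ Qq); rewrite /= !mulmxA -(mulmxA u) phiQ //.
  have -> : u *m phi = 1%:M by rewrite -[u]mulmx1 -(repr_mx1 rM) uphi group1 s1.
  by rewrite !mul1mx.
split; last first.
  apply: (rel_trace_summand (A := a *m phi) (B := v1 *m b)); last by rewrite trT.
    by move=> q Qq /=; rewrite phi_aQ // mulmx1.
  by move=> q Qq /=; rewrite mul1mx v1Q.
split=> [|R /properP[sRQ [x Qx nRx]] [nW [rW [indW sumW]]]].
  apply: (rel_trace_summand (A := a *m phi *m (v1 *m b)) (B := 1%:M)).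
  - by move=> q Qq /=; rewrite mulmxA phi_aQ // -[RHS]mulmxA v1Q.
  - by move=> q Qq /=; rewrite mulmx1 mul1mx.
  by rewrite mulmx1 trT.
have [E0 [P0 [homE homP _ tr1]]] := induced_from_system indW.
have [e [e' [home home' ee']]] := summandP sumW.
(* In a module induced from [R], a contributing coset needs [Q] inside a conjugate of [R], which the
   orders forbid; yet this pairing equals 1. *)
have : w0 *m b *m e *m (e' *m (a *m phi)) = 0.
  apply: (pairing_eq0 chp pQ _ tr1) => [h Rh | q Qq | q Qq | g QRg].
  - by rewrite mulmxA homP // -!mulmxA homE.
  - rewrite -[LHS]mulmxA -home ?inE // mulmxA wL ?(subsetP sQL) //.
    by rewrite chiQ // scale1r.
  - by rewrite [LHS]mulmxA home' ?inE // -mulmxA phi_aQ.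
  have := subset_leq_card QRg; rewrite cardJg => leQR.
  have eqRQ : R :=: Q by apply/eqP; rewrite eqEcard sRQ.
  by rewrite eqRQ Qx in nRx.
rewrite !mulmxA -(mulmxA _ e) ee' mulmx1 wphi => /matrixP/(_ 0 0)/eqP.
by rewrite !mxE eqxx oner_eq0.
Qed.

End Criterion.

(** * Labellings of the points by rows and columns *)

Section Stabilizers.
Variable n : nat.
Local Open Scope group_scope.

Definition stabf (T : eqType) (f : 'I_n -> T) : {set 'S_n} :=
  [set s : 'S_n | [forall i, f (s i) == f i]].

Lemma stabfP (T : eqType) (f : 'I_n -> T) (s : 'S_n) :
  reflect (forall i, f (s i) = f i) (s \in stabf f).
Proof. by rewrite inE; apply: (iffP forallP) => fs i; apply/eqP. Qed.

Lemma stabf_group_set (T : eqType) (f : 'I_n -> T) : group_set (stabf f).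
Proof.
apply/group_setP; split=> [|x y /stabfP fx /stabfP fy]; apply/stabfP=> i.
  by rewrite perm1.
by rewrite permM fy fx.
Qed.
Canonical stabf_group (T : eqType) (f : 'I_n -> T) := Group (stabf_group_set f).

Lemma stabf_conj (T : eqType) (f : 'I_n -> T) g :
  stabf f :^ g = stabf (f \o g^-1).
Proof.
apply/setP=> s; rewrite mem_conjg; apply/stabfP/stabfP => fs i /=.
  by have := fs (g^-1 i); rewrite /conjg invgK !permM permKV.
by have := fs (g i); rewrite /= /conjg invgK !permM permK.
Qed.

Lemma perm_of_fibers (T : eqType) (f g : 'I_n -> T) :
  (forall t, #|[set x | f x == t]| = #|[set x | g x == t]|) ->
  exists s : 'S_n, forall x, f (s x) = g x.
Proof.
move=> fg.
have cntE (h : 'I_n -> T) t :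
    count_mem t [tuple h i | i < n] = #|[set x | h x == t]|.
  by rewrite /= count_map cardsE cardE {2}/enum_mem size_filter -enumT.
have /tuple_permP[s def_g] : perm_eq [tuple g i | i < n] [tuple f i | i < n].
  by apply/allP=> t _ /=; apply/eqP; rewrite !cntE fg.
exists s => x; have /val_inj/(congr1 (fun t : n.-tuple T => tnth t x)) := def_g.
by rewrite !tnth_mktuple.
Qed.

Lemma restr_perm_conj (X Y : {set 'I_n}) (g h : 'S_n) :
    (forall x, (g x \in Y) = (x \in X)) -> h \in 'N(Y | 'P) ->
  odd_perm (restr_perm X (h ^ g^-1)) = odd_perm (restr_perm Y h).
Proof.
move=> gXY nYh; rewrite -(odd_permJ (restr_perm Y h) g^-1); congr odd_perm.
have nXh : h ^ g^-1 \in 'N(X | 'P).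
  apply/astabsP=> x; rewrite /= /conjg invgK /aperm !permM -gXY permKV.
  by rewrite -gXY; have := astabs_act (g x) nYh.
apply/permP=> x; rewrite /conjg invgK in nXh *; rewrite 2!permM.
have [Xx | nXx] := boolP (x \in X).
  by rewrite !restr_permE ?gXY // !permM.
rewrite !(out_perm (restr_perm_on _ _)) ?gXY ?permK //.
Qed.

Lemma restr_permM (T : finType) (X : {set T}) :
  {in 'N(X | 'P) &, {morph (fun s => odd_perm (restr_perm X s)) : x y / x * y >-> x (+) y}}.
Proof. by move=> x y Nx Ny; rewrite /= morphM ?odd_permM. Qed.

Lemma odd_order_sgn (Q : {group 'S_n}) (phi : 'S_n -> bool) :
    odd #|Q| -> {in Q &, {morph phi : x y / x * y >-> x (+) y}} ->
  {in Q, forall q, phi q = false}.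
Proof.
move=> oddQ phiM q Qq.
have phi1 : phi 1 = false by have := phiM 1 1 (group1 Q) (group1 Q); rewrite mulg1; case: (phi 1).
have phiX k : phi (q ^+ k) = odd k && phi q.
  elim: k => [|k IHk]; first by rewrite expg0 phi1.
  by rewrite expgS phiM ?groupX // IHk /=; case: (odd k); case: (phi q).
by have := phiX #|Q|; rewrite oddQ expg_cardG // phi1.
Qed.

End Stabilizers.

(** * Normalizers and signs for points arranged in cells *)

Section Cells.
Variables (n p : nat) (K : eqType).
Variables (col : 'I_n -> K) (R lv ln : 'I_n -> nat) (A : nat).
Local Open Scope group_scope.

Definition cell (x : 'I_n) : K * nat := (col x, R x).
Definition block (x : 'I_n) : {set 'I_n} := [set y | cell y == cell x].
Definition blocks : {set {set 'I_n}} := block @: [set: 'I_n].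
Definition signed_points : {set 'I_n} := [set x | (A <= R x)%N].
Definition rw (x : 'I_n) : nat := if (A <= R x)%N then (R x - A)%N else R x.

(** The exponent of [chi]. A pointwise swap of two blocks of an unsigned column is odd; in a signed
    column the odd number of transpositions of points cancels the transposition of blocks. *)
Definition cell_sign (s : 'S_n) : bool :=
  odd_perm (restr_perm signed_points s) (+)
  odd_perm (restr_perm blocks (actperm ('P^*)%act s)).

Hypotheses (pr_p : prime p) (p_gt2 : (2 < p)%N).
Hypothesis col_lv : forall x y, col x = col y -> lv x = lv y.
Hypothesis col_ty : forall x y, col x = col y -> (A <= R x)%N = (A <= R y)%N.
Hypothesis col_ln : forall x y, col x = col y -> ln x = ln y.
Hypothesis card_block : forall x, #|block x| = (p ^ lv x)%N.
Hypothesis lv_signed : forall x, (A <= R x)%N -> (0 < lv x)%N.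
Hypothesis rw_ln : forall x, (rw x < ln x)%N.
Hypothesis rw_onto : forall x a, (a < ln x)%N -> exists2 y, col y = col x & rw y = a.
(** The form in which restrictedness enters: in a row, fewer than [p] blocks of one level lie in
    columns of a given length. *)
Hypothesis few_blocks : forall x,
  (#|[set y | [&& R y == R x, ln y == ln x & lv y == lv x]]| < p ^ (lv x).+1)%N.

Variable Q : {group 'S_n}.
Local Notation Y0 := (stabf_group cell).
Hypothesis sylQ : p.-Sylow(Y0) Q.
Definition cell_group : {group 'S_n} := 'N(Q) :&: stabf_group col.
Local Notation L := cell_group.

Let pQ : p.-group Q. Proof. exact: pHall_pgroup sylQ. Qed.
Let oddQ : odd #|Q|.
Proof.
have [k ->] := p_natP pQ; rewrite oddX; apply/orP; right.
by case: (even_prime pr_p) p_gt2 => [->|].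
Qed.
Let sQY : Q \subset Y0. Proof. exact: pHall_sub sylQ. Qed.
Let cellQ q x : q \in Q -> cell (q x) = cell x.
Proof. by move=> Qq; have /stabfP := subsetP sQY q Qq. Qed.

Lemma mem_block x : x \in block x. Proof. by rewrite inE. Qed.

Lemma tperm_stabf (T : eqType) (f : 'I_n -> T) x y :
  f x = f y -> tperm x y \in stabf f.
Proof. by move=> fxy; apply/stabfP=> i; case: tpermP => // ->. Qed.

(** [Y0] is transitive on a block, whose size is a power of [p]. Comparing the [p]-parts of group
    and stabilizer orders shows that its Sylow subgroup [Q] is transitive too. *)
Lemma block_orbit x : orbit 'P Q x = block x.
Proof.
apply/eqP; rewrite eqEcard; apply/andP; split.
  by apply/subsetP=> y /orbitP[q Qq <-]; rewrite inE /= /aperm cellQ.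
have blkE : block x = orbit 'P Y0 x.
  apply/setP=> y; rewrite inE; apply/eqP/orbitP=> [yx | [s /stabfP sY <-]].
    by exists (tperm x y); rewrite ?tperm_stabf //= /aperm tpermL.
  exact: sY.
have /= := card_orbit_stab 'P%act Y0 x; rewrite -blkE => cardY.
have cardQ := card_orbit_stab 'P%act Q x.
rewrite card_block in cardY *.
have part_pn : ((p ^ lv x)`_p = p ^ lv x)%N by rewrite part_pnat_id ?pnatX ?pnat_id.
have cardQY : (#|Q| = p ^ lv x * #|'C_Y0[x | 'P]|`_p)%N.
  rewrite (card_Hall sylQ) -cardY partnM ?expn_gt0 ?(prime_gt0 pr_p) ?cardG_gt0 //.
  by rewrite part_pn.
have le_C : (#|'C_Q[x | 'P]| <= #|'C_Y0[x | 'P]|`_p)%N.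
  apply: dvdn_leq; first exact: part_gt0.
  rewrite -(part_pnat_id (pgroupS (subsetIl Q 'C[x | 'P]) pQ)).
  by rewrite partn_dvd ?cardG_gt0 // cardSg // setSI.
rewrite -(leq_pmul2r (cardG_gt0 'C_Q[x | 'P])) cardQ cardQY.
by rewrite leq_mul2l le_C orbT.
Qed.

Lemma constant_on_block (T : Type) (f : 'I_n -> T) x y :
  (forall q z, q \in Q -> f (q z) = f z) -> cell y = cell x -> f y = f x.
Proof.
move=> fQ cyx; have : y \in orbit 'P Q x by rewrite block_orbit inE cyx.
by case/orbitP=> q Qq <-; rewrite fQ.
Qed.

(* A permutation realizing the relabelling conjugates Q to another Sylow subgroup of
   [Y0], which an element of [Y0] brings back to Q. *)
Lemma lift_relabelling (cell' : 'I_n -> K * nat) :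
    (forall q x, q \in Q -> cell' (q x) = cell' x) ->
    (forall t, #|[set x | cell x == t]| = #|[set x | cell' x == t]|) ->
  exists2 l, l \in 'N(Q) & forall x, cell (l x) = cell' x.
Proof.
move=> cellQ' card_c; have [g gP] := perm_of_fibers card_c.
have sQgY : Q :^ g \subset Y0.
  apply/subsetP=> s; rewrite mem_conjg => Qs; apply/stabfP=> x.
  have := cellQ' _ (g^-1 x) Qs; rewrite /conjg invgK !permM permKV -gP permKV => ->.
  by rewrite -gP permKV.
have sylQg : p.-Sylow(Y0) (Q :^ g).
  by rewrite pHallE sQgY cardJg (card_Hall sylQ) /=.
have [y /stabfP Yy defQ] := Sylow_trans sylQg sylQ.
exists (g * y) => [|x]; last by rewrite permM Yy gP.
by apply/normP; rewrite conjsgM -defQ.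
Qed.

Lemma actperm_block (l : 'S_n) x :
  l \in L -> actperm ('P^*)%act l (block x) = block (l x).
Proof.
rewrite inE => /andP[nQl _]; rewrite actpermE -!block_orbit.
by have := setact_orbit 'P%act Q x l; rewrite (normP nQl).
Qed.

Lemma cell_group_astabs_blocks l :
  l \in L -> actperm ('P^*)%act l \in 'N(blocks | 'P).
Proof.
move=> Ll; rewrite !inE /=; apply/subsetP=> _ /imsetP[x _ ->].
by rewrite inE /= /aperm actperm_block ?imset_f.
Qed.

Lemma cell_group_astabs_signed : L \subset 'N(signed_points | 'P).
Proof.
apply/subsetP=> l; rewrite inE => /andP[_ /stabfP cl]; apply/astabsP=> x.
by rewrite !inE /= /aperm (col_ty (cl x)).
Qed.

Lemma cell_signM : {in L &, {morph cell_sign : x y / x * y >-> x (+) y}}.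
Proof.
move=> x y Lx Ly; rewrite /cell_sign.
rewrite actpermM ?inE // !restr_permM ?cell_group_astabs_blocks //;
  try by apply: (subsetP cell_group_astabs_signed).
by rewrite addbACA.
Qed.

Lemma sub_cell_group : Q \subset L.
Proof.
rewrite subsetI normG; apply/subsetP=> q Qq; apply/stabfP=> x.
by have [] := cellQ x Qq.
Qed.

Lemma cell_signQ : {in Q, forall q, cell_sign q = false}.
Proof.
apply: odd_order_sgn => // x y Qx Qy.
by rewrite cell_signM ?(subsetP sub_cell_group).
Qed.

Lemma cell_sign_stab : {in L :&: Y0, forall l,
  cell_sign l = odd_perm (restr_perm signed_points l)}.
Proof.
move=> l; rewrite inE => /andP[Ll /stabfP Yl]; rewrite /cell_sign.
rewrite [X in _ (+) odd_perm X](_ : _ = 1) ?odd_perm1 ?addbF //.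
apply/permP=> B; rewrite perm1.
have [/imsetP[x _ ->] | nB] := boolP (B \in blocks); last first.
  by rewrite (out_perm (restr_perm_on _ _)).
rewrite restr_permE ?cell_group_astabs_blocks ?imset_f // actperm_block //.
by apply/setP=> y; rewrite !inE Yl.
Qed.

(** [T] stands for the row labelling given by a coset of a signed Young subgroup, with sign on the
    rows from [B] on. The condition is the agreement of characters left over by
    [linear_pairing_eq0]. *)
Definition compatible (T : 'I_n -> nat) (B : nat) : Prop :=
  forall k, k \in L -> (forall x, T (k x) = T x) ->
  odd_perm (restr_perm [set x | (B <= T x)%N] k) = cell_sign k.

Lemma odd_restr_tperm (X : {set 'I_n}) x y :
  x != y -> (x \in X) = (y \in X) -> odd_perm (restr_perm X (tperm x y)) = (x \in X).
Proof.
move=> ne_xy xXy.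
have nX : tperm x y \in 'N(X | 'P).
  by apply/astabsP=> z; rewrite /= /aperm; case: tpermP => // ->; rewrite xXy.
have [Xx | nXx] := boolP (x \in X).
  rewrite -[RHS](_ : odd_perm (tperm x y) = _); last by rewrite odd_tperm.
  congr odd_perm; apply/permP=> z; have [Xz | nXz] := boolP (z \in X).
    by rewrite restr_permE.
  rewrite (out_perm (restr_perm_on _ _)) // tpermD //.
    by apply: contraNneq nXz => <-.
  by apply: contraNneq nXz => <-; rewrite -xXy.
rewrite -(odd_perm1 'I_n); congr odd_perm; apply/permP=> z; rewrite perm1.
have [Xz | nXz] := boolP (z \in X); last by rewrite (out_perm (restr_perm_on _ _)).
rewrite restr_permE // tpermD //.
  by apply: contraNneq nXx => ->.
by apply: contraNneq nXx => yz; rewrite xXy yz.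
Qed.

(** * Restrictions on compatible labellings *)

Section Compatible.
Variables (T : 'I_n -> nat) (B : nat).
Hypothesis TQ : forall q x, q \in Q -> T (q x) = T x.
Hypothesis compT : compatible T B.
Local Notation X := [set x | (B <= T x)%N].

Let T_block x y : cell y = cell x -> T y = T x.
Proof. exact: constant_on_block. Qed.

(* A transposition inside a block can be corrected, by an element of [Y0] that is even
   on both sets of points, into an element of N(Q). *)
Lemma compatible_block x y :
  x != y -> cell x = cell y -> (B <= T x)%N = (A <= R x)%N.
Proof.
move=> ne_xy cxy.
have nX : Y0 \subset 'N(X | 'P).
  apply/subsetP=> s /stabfP Ys; apply/astabsP=> z.
  by rewrite !inE /= /aperm (T_block (Ys z)).
have nS : Y0 \subset 'N(signed_points | 'P).
  apply/subsetP=> s /stabfP Ys; apply/astabsP=> z.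
  by rewrite !inE /= /aperm; case: (Ys z) => _ ->.
pose W := [set s in Y0 | ~~ odd_perm (restr_perm X s) &&
                         ~~ odd_perm (restr_perm signed_points s)].
have memW s : s \in W = [&& s \in Y0, ~~ odd_perm (restr_perm X s)
                          & ~~ odd_perm (restr_perm signed_points s)].
  by rewrite in_set.
have WY s : s \in W -> s \in Y0 by rewrite memW => /andP[].
have W_group : group_set W.
  apply/group_setP; split=> [|s t].
    by rewrite memW group1 !morph1.
  rewrite !memW => /and3P[Ys /negPf Xs /negPf Ss] /and3P[Yt /negPf Xt /negPf St].
  by rewrite groupM // !restr_permM ?(subsetP nX) ?(subsetP nS) // Xs Ss Xt St.
have sub_W (P : {group 'S_n}) : P \subset Y0 -> odd #|P| -> P \subset W.
  move=> /subsetP sPY oddP; apply/subsetP=> s Ps; rewrite memW sPY //=.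
  have sgnP (Z : {set 'I_n}) : Y0 \subset 'N(Z | 'P) -> odd_perm (restr_perm Z s) = false.
    move=> /subsetP nZ.
    apply: (odd_order_sgn (phi := fun s => odd_perm (restr_perm Z s)) oddP) => //.
    by move=> u v Pu Pv; rewrite restr_permM ?nZ ?sPY.
  by rewrite !sgnP.
have Yt : tperm x y \in Y0 by apply: tperm_stabf.
have sWY : Group W_group \subset Y0 by apply/subsetP=> s; apply: WY.
have sylQW : p.-Sylow(Group W_group) Q.
  by apply: pHall_subl sylQ => //; apply: sub_W.
have sylQtW : p.-Sylow(Group W_group) (Q :^ tperm x y).
  apply: (pHall_subl _ sWY); last by rewrite pHallJ.
  by apply: sub_W; rewrite ?cardJg // -(conjGid Yt) conjSg.
have [z Wz defQ] := Sylow_trans sylQtW sylQW.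
have Yz := WY z Wz.
have Yk : tperm x y * z \in Y0 by rewrite groupM.
have Lk : tperm x y * z \in L.
  apply/setIP; split.
    by apply/normP; rewrite conjsgM -defQ.
  by apply/stabfP=> w; move/stabfP/(_ w): Yk => [].
have Tk w : T ((tperm x y * z) w) = T w by apply: T_block; move/stabfP: Yk.
have := compT Lk Tk; rewrite cell_sign_stab; last by apply/setIP.
move: Wz; rewrite memW => /and3P[_ /negPf Xz /negPf Sz].
rewrite !restr_permM ?(subsetP nX) ?(subsetP nS) // Xz Sz !addbF.
by rewrite !odd_restr_tperm ?inE //; [case: cxy => _ -> | rewrite (T_block cxy)].
Qed.

(** A signed block has positive level, hence two distinct points, so [compatible_block] applies. *)
Lemma compatible_signed x : (A <= R x)%N -> (B <= T x)%N.
Proof.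
move=> Sx; have : (1 < #|block x|)%N.
  by rewrite card_block -(expn0 p) ltn_exp2l ?lv_signed ?prime_gt1.
rewrite (cardsD1 x) mem_block ltnS card_gt0 => /set0Pn[y].
by rewrite !inE => /andP[ne_yx /eqP cyx]; rewrite (@compatible_block x y) // eq_sym.
Qed.

(** Otherwise some [k] in [L] swaps the blocks of [x] and [y] and preserves [T]. Its signs on the
    two sets of signed points agree, but [cell_sign] also counts the transposition of the two
    blocks. *)
Lemma compatible_inj x y :
  col x = col y -> T x = T y -> (A <= R x)%N || (T x < B)%N -> cell x = cell y.
Proof.
move=> cxy Txy Sx; apply/eqP; apply: contraT => ne_xy.
have TRx : (B <= T x)%N = (A <= R x)%N.
  have [/compatible_signed-> // | /negPf nSx] := boolP (A <= R x)%N.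
  by move: Sx; rewrite nSx /= ltnNge => /negPf.
pose sw (c : K * nat) := if c == cell x then cell y else if c == cell y then cell x else c.
have swK : involutive sw.
  move=> c; rewrite /sw; have [->|nx] := eqVneq c (cell x).
    by rewrite eq_sym (negPf ne_xy) eqxx.
  by have [->|ny] := eqVneq c (cell y); rewrite ?eqxx // (negPf nx) (negPf ny).
have [z | t | k nQk swP] := @lift_relabelling (fun z => sw (cell z)).
- by move=> w Qz; rewrite cellQ.
- have -> : [set z | sw (cell z) == t] = [set z | cell z == sw t].
    by apply/setP=> z; rewrite !inE (can2_eq swK swK).
  rewrite /sw; have [->|nx] := eqVneq t (cell x).
    by rewrite -!/(block _) !card_block (col_lv cxy).
  have [->|ny] := eqVneq t (cell y) => //.
  by rewrite -!/(block _) !card_block (col_lv cxy).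
have colk z : col (k z) = col z.
  have := congr1 fst (swP z); rewrite /= /sw; case: eqP => [[czx _] ->|_] /=.
    by rewrite czx cxy.
  by case: eqP => [[czy _] ->|_ ->] /=; rewrite ?czy.
have Lk : k \in L by apply/setIP; split=> //; apply/stabfP.
have Tk z : T (k z) = T z.
  have := swP z; rewrite /sw; case: eqP => [e1 /T_block->|_].
    by rewrite -Txy (T_block e1).
  by case: eqP => [e1 /T_block->|_ /T_block //]; rewrite Txy (T_block e1).
have := compT Lk Tk; rewrite /cell_sign.
have nXk : k \in 'N(X | 'P) by apply/astabsP=> z; rewrite !inE /= /aperm Tk.
have nSk := subsetP cell_group_astabs_signed k Lk.
(* The two sets differ only at points fixed by [k]: they agree on the swapped blocks by [TRx], and
   on any other block with a moved point by [compatible_block]. *)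
have -> : restr_perm X k = restr_perm signed_points k.
  apply/permP=> z; have eqXS w : cell z = cell w -> (B <= T w)%N = (A <= R w)%N ->
      (z \in X) = (z \in signed_points).
    by move=> czw; rewrite !inE (T_block czw); case: czw => _ ->.
  have [eqz | nez] := eqVneq (z \in X) (z \in signed_points).
    have [Xz | nXz] := boolP (z \in X); first by rewrite !restr_permE // -eqz.
    by rewrite !(out_perm (restr_perm_on _ _)) // -eqz.
  have kz : k z = z.
    apply/eqP; apply: contraT => ne_kz; case/eqP: nez.
    have := @compatible_block z (k z); rewrite eq_sym ne_kz => /(_ isT).
    have := swP z; rewrite /sw; case: eqP => [czx _ _|_]; first exact: eqXS czx TRx.
    case: eqP => [czy _ _|_ -> /(_ erefl)]; last by rewrite !inE.
    by apply: eqXS czy _; rewrite -Txy TRx (col_ty cxy).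
  have fixz (Z : {set 'I_n}) : k \in 'N(Z | 'P) -> restr_perm Z k z = z.
    move=> nZk; have [Zz | nZz] := boolP (z \in Z); first by rewrite restr_permE.
    by rewrite (out_perm (restr_perm_on _ _)).
  by rewrite !fixz.
have block_eq z w : cell z = cell w -> block z = block w.
  by move=> czw; apply/setP=> t; rewrite !inE czw.
have block_inj z w : block z = block w -> cell z = cell w.
  by move/setP/(_ z); rewrite mem_block inE => /esym/eqP.
have -> : restr_perm blocks (actperm ('P^*)%act k) = tperm (block x) (block y).
  apply/permP=> D; have [/imsetP[z _ ->{D}] | nD] := boolP (D \in blocks); last first.
    rewrite (out_perm (restr_perm_on _ _)) // tpermD //.
      by apply: contraNneq nD => <-; apply: imset_f.
    by apply: contraNneq nD => <-; apply: imset_f.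
  rewrite restr_permE ?cell_group_astabs_blocks ?imset_f // actperm_block //.
  have := swP z; rewrite /sw; case: eqP => [czx | nzx].
    by rewrite (block_eq _ _ czx) tpermL => /block_eq.
  case: eqP => [czy | nzy]; first by rewrite (block_eq _ _ czy) tpermR => /block_eq.
  by move/block_eq->; rewrite tpermD // eq_sym; apply/eqP=> /block_inj.
rewrite odd_tperm; case: eqP => [/setP/(_ x)|_ /=]; last by case: odd_perm.
by rewrite mem_block inE (negPf ne_xy).
Qed.
End Compatible.

Lemma rw_inj x y : col x = col y -> rw x = rw y -> cell x = cell y.
Proof.
move=> cxy; rewrite /rw /cell cxy -(col_ty cxy); case: ifP => [Ax | _ -> //] e.
by rewrite -(subnKC Ax) e subnKC // -(col_ty cxy).
Qed.

Lemma cell_rw x y : cell x = cell y -> rw x = rw y.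
Proof. by rewrite /rw => -[_ ->]. Qed.

(** All blocks of a column have the same size, and each value of [v] occurs on at most one of them.
    So [S] is no larger than [k] blocks, or than the whole column if that is shorter. *)
Lemma card_column_le (S : {set 'I_n}) (v : 'I_n -> nat) k x0 :
    {in S, forall x, col x = col x0} -> {in S, forall x, (v x < k)%N} ->
    {in S &, forall x y, v x = v y -> cell x = cell y} ->
  (#|S| <= #|[set y | (col y == col x0) && (rw y < k)%N]|)%N.
Proof.
move=> Scol Sv Sinj.
have [le_kl | lt_lk] := leqP k (ln x0); last first.
  apply/subset_leq_card/subsetP=> x Sx; rewrite inE Scol // eqxx /=.
  by apply: leq_trans (rw_ln x) _; rewrite (col_ln (Scol x Sx)) ltnW.
have -> : S = [set x in S | (v x < k)%N].
  by apply/setP=> x; rewrite inE; case: (boolP (x \in S)) => // /Sv->.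
elim: k {Sv} le_kl => [|k IHk] lt_kl.
  by rewrite [X in #|pred_of_set X|](_ : _ = set0) ?cards0 //; apply/setP=> x; rewrite !inE andbF.
have [y0 cy0 ry0] := rw_onto lt_kl.
rewrite (_ : [set y | _ & _] = [set y | (col y == col x0) && (rw y < k)%N] :|: block y0).
  rewrite cardsU [X in (_ - #|pred_of_set X|)%N](_ : _ = set0); last first.
    apply/setP=> y; rewrite !inE; apply/negP=> /andP[/andP[_ ltr] /eqP/cell_rw].
    by rewrite ry0 => er; rewrite er ltnn in ltr.
  rewrite cards0 subn0.
  rewrite (_ : [set x in S | _] = [set x in S | (v x < k)%N] :|: [set x in S | v x == k]).
    apply: leq_trans (leq_card_setU _ _) _; rewrite leq_add ?IHk ?(ltnW lt_kl) //.
    have [-> | [x]] := set_0Vmem [set x in S | v x == k]; first by rewrite cards0.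
    rewrite inE => /andP[Sx /eqP vx].
    rewrite card_block (col_lv cy0) -(col_lv (Scol x Sx)) -card_block.
    apply/subset_leq_card/subsetP=> y; rewrite !inE => /andP[Sy /eqP vy].
    by apply/eqP/Sinj; rewrite ?vx.
  by apply/setP=> x; rewrite !inE ltnS leq_eqVlt orbC andb_orr.
apply/setP=> y; rewrite !inE ltnS leq_eqVlt orbC andb_orr; congr (_ || _).
apply/andP/eqP=> [[/eqP cy /eqP ry] | cy]; first by apply: rw_inj; rewrite ?cy ?cy0 ?ry.
by rewrite -ry0 (cell_rw cy); case: cy => -> _; rewrite cy0.
Qed.

Lemma card_le_fibers (T : eqType) (c : 'I_n -> T) (S1 S2 : {set 'I_n}) :
    (forall x, #|[set y in S1 | c y == c x]| <= #|[set y in S2 | c y == c x]|)%N ->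
  (#|S1| <= #|S2|)%N /\ (#|S1| = #|S2| -> forall x,
     #|[set y in S1 | c y == c x]| = #|[set y in S2 | c y == c x]|).
Proof.
(* [r] chooses one point in each fibre, so that the fibres are indexed by a finite type. *)
move=> leS; pose r x := odflt x [pick y | c y == c x].
have cr x : c (r x) = c x.
  by rewrite /r; case: pickP => [y /eqP|] //.
have rc x y : c x = c y -> r x = r y.
  rewrite /r => cxy; under eq_pick do rewrite cxy.
  by case: pickP => // /(_ y); rewrite eqxx.
pose fib (S : {set 'I_n}) z := #|[set x in S | r x == z]|.
have cardS (S : {set 'I_n}) : #|S| = \sum_z fib S z.
  rewrite -sum1_card (partition_big r predT) //=; apply: eq_bigr => z _.
  by rewrite /fib -sum1_card; apply: eq_bigl => x; rewrite inE.
have fibE (S : {set 'I_n}) x : fib S (r x) = #|[set y in S | c y == c x]|.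
  apply: eq_card => y; rewrite !inE; congr (_ && _).
  by apply/eqP/eqP=> [e | /rc //]; rewrite -(cr y) e cr.
have le_fib z : (fib S1 z <= fib S2 z)%N.
  have [x /eqP<- | no_x] := pickP (fun x => r x == z); first by rewrite !fibE.
  rewrite /fib [X in (#|pred_of_set X| <= _)%N](_ : _ = set0) ?cards0 //.
  by apply/setP=> x; rewrite !inE no_x andbF.
rewrite !cardS; split=> [|/eqP eqS x]; first exact: leq_sum.
have := leqif_sum (fun z _ => leqif_eq (le_fib z)) => /(_ predT)[_].
by rewrite eqS => /esym/forallP/(_ (r x))/eqP; rewrite !fibE.
Qed.

(** * Dominance from compatible labellings *)

Section Dominance.
Variables (T : 'I_n -> nat) (B : nat).
Hypothesis TQ : forall q x, q \in Q -> T (q x) = T x.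
Hypothesis compT : compatible T B.

(** The bound [minn k B] selects the first [k] unsigned rows. Signed columns avoid them, and the
    blocks of an unsigned column in these rows lie in distinct ones. *)
Lemma column_le_unsigned k x0 :
  (#|[set y in [set x | (T x < minn k B)%N] | col y == col x0]| <=
   #|[set y in [set x | (R x < minn k A)%N] | col y == col x0]|)%N.
Proof.
have [Sx0 | nSx0] := boolP (A <= R x0)%N.
  rewrite [X in (#|pred_of_set X| <= _)%N](_ : _ = set0) ?cards0 //.
  apply/setP=> y; rewrite !inE leq_min; apply/negP=> /andP[/andP[_ ltB] /eqP cy].
  by rewrite ltnNge (compatible_signed TQ compT) // (col_ty cy) in ltB.
apply: leq_trans (card_column_le (v := T) (k := k) (x0 := x0) _ _ _) _.
- by move=> x; rewrite !inE => /andP[_ /eqP].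
- by move=> x; rewrite !inE leq_min => /andP[/andP[]].
- move=> x y; rewrite !inE leq_min => /andP[/andP[_ xB] /eqP cx] /andP[_ /eqP cy] e.
  by apply: (compatible_inj TQ compT) => //; rewrite ?cx ?cy // xB orbT.
apply/subset_leq_card/subsetP=> x; rewrite !inE leq_min => /andP[/eqP cx].
by rewrite cx eqxx andbT /rw (col_ty cx) (negPf nSx0) => ->; rewrite ltnNge (col_ty cx).
Qed.

Lemma column_le_signed k x0 :
  (#|[set y in [set x | (T x < B + k)%N] | col y == col x0]| <=
   #|[set y in [set x | (R x < A + k)%N] | col y == col x0]|)%N.
Proof.
have [Sx0 | nSx0] := boolP (A <= R x0)%N; last first.
  apply/subset_leq_card/subsetP=> x; rewrite !inE => /andP[_ /eqP cx].
  rewrite cx eqxx andbT; apply: leq_trans (leq_addr _ _).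
  by rewrite ltnNge (col_ty cx).
have BT y : col y = col x0 -> (B <= T y)%N.
  by move=> cy; apply: (compatible_signed TQ compT); rewrite (col_ty cy).
apply: leq_trans (card_column_le (v := fun x => (T x - B)%N) (k := k) (x0 := x0) _ _ _) _.
- by move=> x; rewrite !inE => /andP[_ /eqP].
- by move=> x; rewrite !inE => /andP[ltT /eqP/BT leB]; rewrite ltn_subLR.
- move=> x y; rewrite !inE => /andP[_ /eqP cx] /andP[_ /eqP cy] e.
  apply: (compatible_inj TQ compT); rewrite ?cx ?cy ?(col_ty cx) ?Sx0 //.
  by rewrite -(subnKC (BT x cx)) e subnKC ?BT.
apply/subset_leq_card/subsetP=> x; rewrite !inE => /andP[/eqP cx].
by rewrite cx eqxx andbT /rw (col_ty cx) Sx0 ltn_subLR // (col_ty cx).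
Qed.

Lemma compatible_dominated k :
  (#|[set x | (T x < minn k B)%N]| <= #|[set x | (R x < minn k A)%N]|)%N /\
  (#|[set x | (T x < B + k)%N]| <= #|[set x | (R x < A + k)%N]|)%N.
Proof.
by split; apply: (card_le_fibers (c := col) _).1 => x;
  [apply: column_le_unsigned | apply: column_le_signed].
Qed.

(** Equal row sizes turn the inequalities summed over the columns into equalities, hence also those
    for each column. So [T] and [R] distribute each column equally over the rows and differ by a
    relabelling within columns. *)
Lemma compatible_transitive :
    B = A -> (forall t, #|[set x | T x == t]| = #|[set x | R x == t]|) ->
  exists2 l, l \in L & forall x, R (l x) = T x.
Proof.
move=> eqBA fibT.
have ltTR k : #|[set x | (T x < k)%N]| = #|[set x | (R x < k)%N]|.
  elim: k => [|k IHk]; first by apply: eq_card => x; rewrite !inE.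
  have splitk (f : 'I_n -> nat) : #|[set x | (f x < k.+1)%N]| =
      (#|[set x | (f x < k)%N]| + #|[set x | f x == k]|)%N.
    rewrite -cardsUI [X in (_ + #|pred_of_set X|)%N](_ : _ = set0) ?cards0 ?addn0.
      by apply: eq_card => x; rewrite !inE ltnS leq_eqVlt orbC.
    by apply/setP=> x; rewrite !inE; case: ltngtP.
  by rewrite !splitk IHk fibT.
have colTR k x0 : #|[set y in [set x | (T x < k)%N] | col y == col x0]| =
    #|[set y in [set x | (R x < k)%N] | col y == col x0]|.
  have [le_kA | /ltnW le_Ak] := leqP k A.
    have /card_le_fibers[_] := column_le_unsigned k.
    by rewrite eqBA (minn_idPl le_kA) ltTR => ->.
  have /card_le_fibers[_] := column_le_signed (k - A).
  by rewrite eqBA subnKC // ltTR => ->.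
have colT t x0 : #|[set y | (T y == t) && (col y == col x0)]| =
    #|[set y | (R y == t) && (col y == col x0)]|.
  have splitk (f : 'I_n -> nat) : #|[set y in [set x | (f x < t.+1)%N] | col y == col x0]| =
      (#|[set y in [set x | (f x < t)%N] | col y == col x0]| +
       #|[set y | (f y == t) && (col y == col x0)]|)%N.
    rewrite -cardsUI [X in (_ + #|pred_of_set X|)%N](_ : _ = set0) ?cards0 ?addn0.
      by apply: eq_card => x; rewrite !inE ltnS leq_eqVlt orbC andb_orl.
    by apply/setP=> x; rewrite !inE; case: ltngtP => //=; rewrite ?andbF.
  by have := colTR t.+1 x0; rewrite !splitk colTR => /addnI.
have [q x Qq | [c t] | l nQl lP] := @lift_relabelling (fun x => (col x, T x)).
- by rewrite TQ //; case: (cellQ x Qq) => ->.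
- have [x0 /eqP cx0 | no_x0] := pickP (fun x => col x == c).
    transitivity #|[set y | (R y == t) && (col y == col x0)]|; last rewrite -colT;
    by apply: eq_card => y; rewrite !inE xpair_eqE -cx0 andbC.
  by apply: eq_card => y; rewrite !inE !xpair_eqE !no_x0.
have lc x : col (l x) = col x by case: (lP x).
exists l => [|x]; last by case: (lP x).
by apply/setIP; split=> //; apply/stabfP.
Qed.

End Dominance.

(** * Reversal of the columns *)

Definition revR (x : 'I_n) : nat :=
  if (A <= R x)%N then (A + ((ln x).-1 - rw x))%N else ((ln x).-1 - rw x)%N.

Hypothesis ln_unsigned : forall x, (R x < A)%N -> (ln x <= A)%N.

Lemma revR_signed x : (A <= revR x)%N = (A <= R x)%N.
Proof.
rewrite /revR; case: ifP => [_ | /negbT]; first by rewrite leq_addr.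
rewrite -ltnNge => ltA; apply/negbTE; rewrite -ltnNge.
apply: leq_ltn_trans (leq_subr _ _) _.
by have := rw_ln x; case: (ln x) (ln_unsigned ltA).
Qed.

Lemma reversed_cell x : exists y, [/\ col y = col x, R y = revR x & revR y = R x].
Proof.
have ltx := rw_ln x; have lt_rev : ((ln x).-1 - rw x < ln x)%N.
  by case: (ln x) ltx => // l _; rewrite ltnS leq_subr.
have [y cy ry] := rw_onto lt_rev.
have Ry : R y = revR x.
  rewrite /revR -ry /rw (col_ty cy); case: (boolP (A <= R x)%N) => // Ax.
  by rewrite subnKC // (col_ty cy).
exists y; split=> //; rewrite /revR (col_ty cy) ry (col_ln cy) subKn; last first.
  by case: (ln x) ltx.
by rewrite /rw; case: (boolP (A <= R x)%N) => // Ax; rewrite subnKC.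
Qed.

Lemma revR_cell x y : cell x = cell y -> revR x = revR y.
Proof.
move=> cxy; rewrite /revR (cell_rw cxy); case: cxy => cxy ->.
by rewrite (col_ln cxy).
Qed.

Lemma revR_inj x y : col x = col y -> revR x = revR y -> cell x = cell y.
Proof.
move=> cxy e; have [x' [cx' Rx' rx']] := reversed_cell x.
have [y' [cy' Ry' ry']] := reversed_cell y.
rewrite /cell cxy -rx' -ry'; congr (_, _); apply: revR_cell.
by rewrite /cell cx' cy' cxy Rx' Ry' e.
Qed.

Lemma column_reversal : exists2 s, s \in L & forall x, R (s x) = revR x.
Proof.
have [q x Qq | [c t] | s nQs sP] := @lift_relabelling (fun x => (col x, revR x)).
- have cq := cellQ x Qq; rewrite (revR_cell cq).
  by case: cq => ->.
- have [x0 /eqP cx0 | no_x0] := pickP (fun x => cell x == (c, t)); last first.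
    rewrite [LHS](_ : _ = 0%N); last first.
      by apply/eqP; rewrite cards_eq0; apply/eqP/setP=> x; rewrite !inE no_x0.
    apply/esym/eqP; rewrite cards_eq0; apply/eqP/setP=> x; rewrite !inE.
    apply/negP=> /eqP[cx rx]; have [y [cy Ry _]] := reversed_cell x.
    by have := no_x0 y; rewrite /cell cy Ry cx rx eqxx.
  have [y [cy Ry ry]] := reversed_cell x0.
  transitivity #|block x0|; first by apply: eq_card => x; rewrite !inE cx0.
  transitivity #|block y|; first by rewrite !card_block (col_lv cy).
  apply: eq_card => x; rewrite !inE; apply/eqP/eqP=> [cxy | [cx rx]].
    rewrite (revR_cell cxy) ry; case: (cxy) => -> _; rewrite cy.
    by case: cx0 => <- <-.
  by apply: revR_inj; [rewrite cx cy | rewrite rx ry]; case: cx0.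
have cs x : col (s x) = col x by case: (sP x).
exists s => [|x]; last by case: (sP x).
by apply/setIP; split=> //; apply/stabfP.
Qed.

Section Reversal.
Variable sigma : 'S_n.
Hypothesis Lsigma : sigma \in L.
Hypothesis Rsigma : forall x, R (sigma x) = revR x.

Let col_sigma x : col (sigma x) = col x.
Proof. by case/setIP: Lsigma => _ /stabfP. Qed.

(** Reversal is an involution on cells, so [sigma] and its inverse act alike on rows. *)
Lemma RsigmaV x : R (sigma^-1 x) = revR x.
Proof.
have [y [cy Ry ry]] := reversed_cell (sigma^-1 x).
rewrite -ry; apply: revR_cell; rewrite /cell cy Ry -Rsigma permKV.
by rewrite -[in col x](permKV sigma x) col_sigma.
Qed.

Lemma rw_revR x : (rw (sigma x) + rw x)%N = (ln x).-1.
Proof.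
have le_rw : (rw x <= (ln x).-1)%N by have := rw_ln x; case: (ln x).
rewrite {1}/rw Rsigma revR_signed /revR.
by case: (A <= R x)%N; rewrite ?addKn subnK.
Qed.

(* Summing the squares of [rw x + rw (l x) - (ln x - 1)] over all points x. *)
Lemma reversal_unique l :
    l \in L ->
    (\sum_x rw x * rw (l x) = \sum_x rw x * rw (sigma x))%N ->
  forall x, R (l x) = revR x.
Proof.
move=> Ll sum_eq; have /setIP[_ /stabfP cl] := Ll.
pose a (x : 'I_n) := (rw x)%:Z; pose m (x : 'I_n) := ((ln x).-1)%:Z.
have ml x : m (l x) = m x by rewrite /m (col_ln (cl x)).
have ms x : m (sigma x) = m x by rewrite /m (col_ln (col_sigma x)).
have as_ x : (a (sigma x) = m x - a x)%R.
  by rewrite /a /m -rw_revR PoszD addrK.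
have sum_l (f : 'I_n -> int) : (\sum_x f (l x) = \sum_x f x)%R.
  by rewrite [RHS](reindex_inj (@perm_inj _ l)).
have sum_s (f : 'I_n -> int) : (\sum_x f (sigma x) = \sum_x f x)%R.
  by rewrite [RHS](reindex_inj (@perm_inj _ sigma)).
have sumE : (\sum_x a x * a (l x) = \sum_x a x * a (sigma x))%R.
  have := congr1 Posz sum_eq; rewrite !(big_morph Posz PoszD (erefl _)).
  by under eq_bigr do rewrite PoszM; under [RHS]eq_bigr do rewrite PoszM.
have mm : (\sum_x m x * m x = \sum_x a x * m x + \sum_x a x * m x)%R.
  rewrite -{1}(sum_s (fun x => a x * m x)%R) -big_split /=.
  by apply: eq_bigr => x _; rewrite as_ ms mulrBl subrK.
(* Expanded, only the sum of [a x * a (l x)] depends on [l]. It is the same for [sigma], for which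
   every square is 0. *)
have sq0 : (\sum_x (a x + a (l x) - m x) ^+ 2 = 0)%R.
  have expand x : ((a x + a (l x) - m x) ^+ 2 =
      a x * a x + a (l x) * a (l x) + m x * m x + (a x * a (l x) + a x * a (l x))
      - (a x * m x + a x * m x) - (a (l x) * m (l x) + a (l x) * m (l x)))%R.
    by rewrite ml; ring.
  under eq_bigr do rewrite expand.
  rewrite !(sumrB, big_split) /= sumE (sum_l (fun x => a x * a x)%R).
  rewrite (sum_l (fun x => a x * m x)%R) mm.
  under [X in (_ + (X + _))%R]eq_bigr do rewrite as_ mulrBr.
  under [X in (_ + (_ + X))%R]eq_bigr do rewrite as_ mulrBr.
  by rewrite sumrB; ring.
have sq_ge0 z : true -> (0 <= (a z + a (l z) - m z) ^+ 2)%R by rewrite sqr_ge0.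
move=> x; have /eqP := @psumr_eq0P _ _ predT _ sq_ge0 sq0 x isT.
rewrite sqrf_eq0 subr_eq0 /a /m -rw_revR -PoszD eqz_nat addnC eqn_add2r => /eqP rwE.
have [_ ->] : cell (l x) = cell (sigma x) by apply: rw_inj; rewrite ?cl ?col_sigma.
exact: Rsigma.
Qed.

(** Here [l = y sigma h] with [y] and [h] preserving rows, so the sum in [reversal_unique] is the
    same for [l] and [sigma]. Thus [l] reverses the columns as well. *)
Lemma coset_reversal h l : h \in stabf R -> l \in L ->
  l * (sigma * h)^-1 \in stabf R -> l * sigma^-1 \in stabf R.
Proof.
set y := l * _ => /stabfP hR Ll /stabfP yR.
have yE : y * (sigma * h) = l by rewrite /y mulgKV.
have lE i : l i = h (sigma (y i)) by rewrite -{1}yE !permM.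
clearbody y.
have rwR i j : R i = R j -> rw i = rw j by rewrite /rw => ->.
have lR : forall x, R (l x) = revR x.
  apply: reversal_unique => //.
  rewrite [RHS](reindex_inj (@perm_inj _ y)); apply: eq_bigr => x _ /=.
  by congr (_ * _)%N; apply: rwR; rewrite ?yR // lE hR.
apply/stabfP=> i; rewrite permM RsigmaV.
have [z [cz Rz <-]] := reversed_cell i; apply: revR_cell.
by rewrite /cell lR Rz cz; case/setIP: Ll => _ /stabfP->.
Qed.

(* Let P be a p-subgroup of the row stabilizers that contains Q. A P-orbit O is a union
   of blocks with the same row and column length, so it has fewer than p blocks of its
   lowest level i. If |O| > p^i, then p^(i+1) would divide |O|, hence the number of
   points of O of level i. So O is a block. *)
Lemma sylow_row_stabilizer :
  p.-Sylow(stabf_group R :&: stabf_group R :^ sigma^-1) Q.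
Proof.
pose E := (stabf_group R :&: stabf_group R :^ sigma^-1)%G; rewrite -[X in p.-Sylow(X) _]/(gval E).
have memE s : s \in E -> forall x, R (s x) = R x /\ revR (s x) = revR x.
  rewrite inE mem_conjg invgK => /andP[/stabfP sR /stabfP sS] x; split=> //.
  by have := sS (sigma x); rewrite /conjg !permM permK !Rsigma.
have sQE : Q \subset E.
  have sQR : Q \subset stabf_group R.
    by apply/subsetP=> q Qq; apply/stabfP=> x; case: (cellQ x Qq).
  rewrite subsetI sQR -sub_conjg (normP _) //.
  by case/setIP: Lsigma.
have [P sylP sQP] := Sylow_superset sQE pQ.
suff sPY : P \subset Y0.
  by rewrite -(sub_pHall sylQ (pHall_pgroup sylP) sQP sPY).
have actQ : forall W : {set 'I_n}, (forall q, q \in Q -> forall z, z \in W -> q z \in W) ->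
    [acts Q, on W | 'P].
  move=> W QW; apply/subsetP=> q Qq; rewrite !inE; apply/subsetP=> z Wz.
  by rewrite inE /= /aperm QW.
have dvd_card (W : {set 'I_n}) i :
    (forall q, q \in Q -> forall z, z \in W -> q z \in W) ->
    (forall z, z \in W -> (i <= lv z)%N) -> (p ^ i %| #|W|)%N.
  move=> /actQ QW le_i; rewrite -(acts_sum_card_orbit QW); apply: dvdn_sum => _ /imsetP[z Wz ->].
  by rewrite block_orbit card_block dvdn_exp2l ?le_i.
apply/subsetP=> s Ps; apply/stabfP=> x.
pose O := orbit 'P P x.
(* [P] preserves both the rows and the reversed rows, and together these determine the column
   length. *)
have memO z : z \in O -> R z = R x /\ ln z = ln x.
  case/orbitP=> t Pt <-; have [Rt rt] := memE t (subsetP (pHall_sub sylP) t Pt) x.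
  rewrite /= /aperm; split=> //.
  have rwt : rw (t x) = rw x by rewrite /rw Rt.
  move: rt (rw_ln x) (rw_ln (t x)); rewrite /revR Rt rwt => rt.
  have {rt} : ((ln (t x)).-1 - rw x = (ln x).-1 - rw x)%N.
    by move: rt; case: ifP => // _ /addnI.
  case: (ln x) (ln (t x)) => [|a] [|b] //= e; rewrite !ltnS => le_a le_b.
  by rewrite -(subnKC le_b) e subnKC.
have Ox : x \in O by apply: orbit_refl.
have [z0 Oz0 min_z0] := @arg_minnP _ x [in O] lv Ox; rewrite unfold_in in Oz0.
change (is_true (z0 \in O)) in Oz0.
have QO q : q \in Q -> forall z, z \in O -> q z \in O.
  by move=> Qq z; rewrite /O -[z \in _](@orbit_actr _ _ 'P%act P q x z) ?(subsetP sQP).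
suff defO : O = block z0.
  have : s x \in O by apply: mem_orbit.
  by move: Ox; rewrite defO !inE => /eqP-> /eqP->.
have pO : p.-nat #|O| := pnat_dvd (dvdn_orbit 'P%act P x) (pHall_pgroup sylP).
have sbO : block z0 \subset O.
  by rewrite -block_orbit; apply/subsetP=> _ /orbitP[q Qq <-]; apply: QO.
apply/esym/eqP; rewrite eqEcard sbO card_block.
case/p_natP: pO => j cardO; rewrite cardO leq_exp2l ?prime_gt1 //.
rewrite leqNgt; apply/negP=> lt_j.
have dvdO : (p ^ (lv z0).+1 %| #|O|)%N by rewrite cardO dvdn_exp2l.
pose O1 := [set z in O | lv z == lv z0]; pose O2 := [set z in O | (lv z0 < lv z)%N].
have lvQ q z : q \in Q -> lv (q z) = lv z.
  by move=> Qq; apply: col_lv; case: (cellQ z Qq).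
have dvdO2 : (p ^ (lv z0).+1 %| #|O2|)%N.
  apply: dvd_card => [q Qq z | z]; last by rewrite inE => /andP[].
  by rewrite !inE lvQ // => /andP[Oz ->]; rewrite QO.
have : (p ^ (lv z0).+1 %| #|O1|)%N.
  rewrite -(dvdn_addl _ dvdO2) -cardsUI [X in (_ + #|pred_of_set X|)%N](_ : _ = set0).
    rewrite cards0 addn0 (_ : O1 :|: O2 = O) //; apply/setP=> z; rewrite !inE -andb_orr.
    by case: (boolP (z \in O)) => //= Oz; rewrite eq_sym -leq_eqVlt min_z0.
  by apply/setP=> z; rewrite !inE; case: ltngtP; rewrite ?andbF.
apply/negP; apply: contraL (few_blocks z0); rewrite -leqNgt => /dvdn_leq leO1.
apply: leq_trans (leO1 _) _.
  by rewrite card_gt0; apply/set0Pn; exists z0; rewrite inE Oz0 eqxx.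
apply/subset_leq_card/subsetP=> z; rewrite !inE => /andP[/memO[-> ->] ->].
by have [-> ->] := memO _ Oz0; rewrite !eqxx.
Qed.

End Reversal.

(** * From labellings to signed permutation modules *)

Section CellModules.
Variable F : fieldType.
Hypothesis chp : p \in [pchar F]%R.
Local Open Scope ring_scope.

Definition set_sign (X : {set 'I_n}) (g : 'S_n) : F := (-1) ^+ odd_perm (restr_perm X g).
Definition cell_char (g : 'S_n) : F := (-1) ^+ cell_sign g.

Lemma cell_charQ : {in Q, forall q, cell_char q = 1}.
Proof. by move=> q Qq; rewrite /cell_char cell_signQ ?expr0. Qed.

Let stab_at (f : 'I_n -> nat) (B : nat) (g h : 'S_n) :
  h \in (stabf f :^ g)%g ->
  set_sign [set x | B <= f x]%N (h ^ g^-1)%g =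
  (-1) ^+ odd_perm (restr_perm [set x | B <= f (g^-1 x)%g]%N h).
Proof.
rewrite stabf_conj => /stabfP fh; congr (_ ^+ nat_of_bool _).
apply: restr_perm_conj => [x|]; first by rewrite !inE permK.
by apply/astabsP=> x; rewrite !inE; have /= -> := fh x.
Qed.

(** As [p] is odd, -1 differs from 1 in [F], so equal signs in [F] mean equal parities. *)
Lemma compatible_of_char (f : 'I_n -> nat) (B : nat) g :
  {in (L :&: stabf f :^ g)%g, forall h,
     set_sign [set x | B <= f x]%N (h ^ g^-1)%g = cell_char h} ->
  compatible (f \o g^-1)%g B.
Proof.
move=> eq_char k Lk fk.
have Hk : k \in (stabf f :^ g)%g by rewrite stabf_conj; apply/stabfP.
have := eq_char k; rewrite inE Lk Hk => /(_ isT).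
rewrite stab_at // /cell_char /=; have ne1 : -1 != 1 :> F.
  apply/eqP=> /esym/eqP; rewrite -addr_eq0 -(natrD _ 1 1) -(dvdn_pcharf chp).
  by move/dvdn_leq => /(_ isT); rewrite leqNgt p_gt2.
case: odd_perm; case: cell_sign => // /eqP; rewrite ?expr0 ?expr1.
  by rewrite (negPf ne1).
by rewrite eq_sym (negPf ne1).
Qed.

Lemma fixed_coset (f : 'I_n -> nat) g q x :
  Q \subset (stabf f :^ g)%g -> q \in Q -> (f \o g^-1)%g (q x) = (f \o g^-1)%g x.
Proof. by rewrite stabf_conj => /subsetP sQ /sQ/stabfP. Qed.

(** A contributing coset [H g] gives the labelling [f \o g^-1], with the row sizes of [f]. It is
    [Q]-invariant because [Q] fixes the coset, and compatible because the characters agree. *)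
Lemma undetected_of_incompatible (f : 'I_n -> nat) (B : nat) m
    (rV : mx_representation F [set: 'S_n]%G m) u phi :
    linear_system (stabf_group f) (set_sign [set x | B <= f x]%N) rV u phi ->
    (forall T : 'I_n -> nat, (forall t, #|[set x | T x == t]| = #|[set x | f x == t]|) ->
       (forall q x, q \in Q -> T (q x) = T x) -> ~ compatible T B) ->
  undetected Q L cell_char rV.
Proof.
move=> sysV incomp v w vL wQ.
apply: (linear_pairing_eq0 chp pQ sub_cell_group cell_charQ sysV vL wQ) => g Qg eq_char.
case: (incomp (f \o g^-1)%g) => [t | q x Qq |].
- rewrite -[RHS](card_imset _ (@perm_inj _ g)); apply: eq_card => x.
  rewrite !inE /=; apply/eqP/imsetP=> [fx | [y]].
    by exists (g^-1%g x); rewrite ?inE ?permKV ?fx.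
  by rewrite inE => /eqP fy ->; rewrite permK.
- exact: fixed_coset Qg Qq.
exact: compatible_of_char eq_char.
Qed.

Theorem cells_vertex m (rM : mx_representation F [set: 'S_n]%G m) u phi
    d (rY : mx_representation F [set: 'S_n]%G d)
    k (rN : mx_representation F [set: 'S_n]%G k) :
    linear_system (stabf_group R) (set_sign signed_points) rM u phi ->
    indecomposable rY -> mx_rsim (dsum_repr rY rN) rM -> undetected Q L cell_char rN ->
  vertex rY Q /\ trivial_source_at rY Q.
Proof.
move=> sysM indY simM undetN.
have [sigma Lsigma Rsigma] := column_reversal.
have sqr_sign (b : bool) : (-1) ^+ b * (-1) ^+ b = 1 :> F by rewrite -signr_addb addbb.
have sQR : Q \subset stabf_group R.
  by apply/subsetP=> q Qq; apply/stabfP=> x; case: (cellQ x Qq).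
have nRS : stabf R \subset 'N(signed_points | 'P)%g.
  by apply/subsetP=> s /stabfP Rs; apply/astabsP=> x; rewrite !inE /= /aperm Rs.
apply: (vertex_trivial_source (sigma := sigma) (H := stabf_group R)
  (s := set_sign signed_points) chp pQ sub_cell_group _ _ cell_charQ sQR _ _ Lsigma
  (sylow_row_stabilizer Lsigma Rsigma) _ (coset_reversal Lsigma Rsigma) _ sysM
  indY simM undetN).
- by move=> x y Lx Ly; rewrite /cell_char cell_signM // signr_addb.
- by move=> x _; apply: sqr_sign.
- by move=> x _; apply: sqr_sign.
- move=> h /setIP[/stabfP Rh Lh]; rewrite /set_sign /cell_char cell_sign_stab //.
  apply/setIP; split=> //; apply/stabfP=> x; rewrite /cell Rh.
  by case/setIP: Lh => _ /stabfP->.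
- move=> h; rewrite inE => /andP[Hh _]; rewrite /set_sign.
  rewrite -{1}[sigma]invgK (@restr_perm_conj _ signed_points signed_points) //.
    by move=> x; rewrite !inE (RsigmaV Lsigma Rsigma) revR_signed.
  exact: (subsetP nRS).
(* For [cosets_L]: the labelling attached to [g] is compatible and has the row sizes of [R], so
   [compatible_transitive] provides an element of [L]. *)
move=> g Qg eq_char; have compR := compatible_of_char eq_char.
have [q x Qq | //| t | l Ll lR] := @compatible_transitive _ A _ compR.
- exact: fixed_coset Qg Qq.
- rewrite -[RHS](card_imset _ (@perm_inj _ g)); apply: eq_card => x.
  rewrite !inE /=; apply/eqP/imsetP=> [fx | [y]].
    by exists (g^-1%g x); rewrite ?inE ?permKV ?fx.
  by rewrite inE => /eqP fy ->; rewrite permK.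
exists l^-1%g; first by rewrite groupV.
by apply/stabfP=> x; rewrite invgK permM lR /= permK.
Qed.

End CellModules.
End Cells.

(** * The cells of a pair of p-adic expansions *)

Section Compositions.
Local Open Scope nat_scope.

Lemma nth_padd s t j : nth 0 (padd s t) j = nth 0 s j + nth 0 t j.
Proof.
rewrite /padd; have [ltj | lej] := ltnP j (maxn (size s) (size t)).
  by rewrite nth_mkseq.
by move: lej; rewrite geq_max => /andP[les let_]; rewrite !nth_default ?size_mkseq ?geq_max ?les.
Qed.

Lemma nth_pscale k s j : nth 0 (pscale k s) j = k * nth 0 s j.
Proof.
have [ltj | lej] := ltnP j (size s); first by rewrite (nth_map 0).
by rewrite !nth_default ?size_map ?muln0.
Qed.

Lemma nth_psum p ls j N : size ls <= N ->
  nth 0 (psum p ls) j = \sum_(i < N) p ^ i * nth 0 (nth [::] ls i) j.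
Proof.
elim: ls N => [|l ls IHls] N leN.
  by rewrite nth_nil big1 // => i _; rewrite nth_nil nth_nil muln0.
case: N leN => // N leN; rewrite /= nth_padd nth_pscale big_ord_recl mul1n /=.
rewrite (IHls N) // big_distrr /=; congr (_ + _); apply: eq_bigr => i _.
by rewrite /bump add1n expnS mulnA.
Qed.

Lemma sumn_nth s N : size s <= N -> sumn s = \sum_(j < N) nth 0 s j.
Proof.
elim: s N => [|v s IHs] N leN; first by rewrite big1 // => i _; rewrite nth_nil.
by case: N leN => // N leN; rewrite big_ord_recl /= (IHs N).
Qed.

Lemma sumn_take_lt s k : k < size s -> sumn (take k.+1 s) = sumn (take k s) + nth 0 s k.
Proof. by move=> ltk; rewrite (take_nth 0) // -cats1 sumn_cat /= addn0. Qed.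

Lemma sumn_takeS s k : sumn (take k.+1 s) = sumn (take k s) + nth 0 s k.
Proof.
have [ltk | lek] := ltnP k (size s); first exact: sumn_take_lt.
by rewrite !take_oversize ?(leqW lek) // nth_default ?addn0.
Qed.

Lemma blk_cons r rho x : blk (r :: rho) x = if x < r then 0 else (blk rho (x - r)).+1.
Proof.
rewrite /blk /= take0 /= addn0 (iotaDl 1 0) count_map.
case: ltnP => [ltx | lex].
  rewrite add0n; apply/eqP; rewrite -leqn0 leqNgt -has_count; apply/hasPn=> k _ /=.
  by rewrite -ltnNge (leq_trans ltx) ?leq_addr.
by congr (_.+1); apply: eq_count => k /=; rewrite add1n /= leq_subRL // addnC.
Qed.

Lemma blk_lt rho x k : x < sumn rho -> (blk rho x < k) = (x < sumn (take k rho)).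
Proof.
elim: rho x k => // r rho IHrho x [|k] ltx; first by rewrite take0.
rewrite blk_cons /=; case: (ltnP x r) => [ltr | ler]; first by rewrite (leq_trans ltr) ?leq_addr.
by rewrite ltnS IHrho ?ltn_subLR.
Qed.

Lemma card_blk_lt n rho k : sumn rho = n ->
  #|[set x : 'I_n | blk rho x < k]| = sumn (take k rho).
Proof.
move=> def_n; have le_n : sumn (take k rho) <= n.
  by rewrite -def_n -{2}(cat_take_drop k rho) sumn_cat leq_addr.
have inj_w : injective (widen_ord le_n) by move=> a b /(congr1 val) e; apply: val_inj.
rewrite -[RHS]card_ord -cardsT -[RHS](card_imset _ inj_w).
apply: eq_card => x; rewrite inE blk_lt ?def_n ?ltn_ord //; apply/idP/imsetP => [ltx | [y _ ->]].
  by exists (Ordinal ltx) => //; apply: val_inj.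
exact: (ltn_ord y).
Qed.

Lemma card_blk_eq n rho j : sumn rho = n ->
  #|[set x : 'I_n | blk rho x == j]| = nth 0 rho j.
Proof.
move=> def_n; apply: (@addnI #|[set x : 'I_n | blk rho x < j]|).
rewrite [in RHS](card_blk_lt _ def_n) -sumn_takeS -(card_blk_lt _ def_n).
rewrite -cardsUI [X in _ + #|pred_of_set X| = _](_ : _ = set0) ?cards0 ?addn0.
  by apply: eq_card => x; rewrite !inE ltnS [RHS]leq_eqVlt orbC.
by apply/setP=> x; rewrite !inE; case: ltngtP.
Qed.

(** The count is the length of column [c], a part of the conjugate partition. *)
Lemma nth_partition s c a : sorted geq s ->
  (c < nth 0 s a) = (a < count (fun v => c < v) s).
Proof.
elim: s a => [|v s IHs] a /=; first by rewrite nth_nil.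
move=> path_s; have sorted_s := path_sorted path_s.
have le_v : all (fun w => w <= v) s.
  by apply: order_path_min path_s => x y z; rewrite /geq /= => h1 h2; apply: leq_trans h2 h1.
case: (ltnP c v) => [ltcv | levc] /=; first by case: a => // a; rewrite IHs.
have -> : count (fun v => c < v) s = 0.
  apply/eqP; rewrite -leqn0 leqNgt -has_count; apply/hasPn=> w /(allP le_v) lew.
  by rewrite -leqNgt (leq_trans lew).
case: a => [|a]; first by rewrite /= ltnNge levc.
rewrite /= ltnNge; apply/negbTE; rewrite negbK.
have [lta | lea] := ltnP a (size s); last by rewrite nth_default.
by apply: leq_trans levc; apply: (allP le_v); apply: mem_nth.
Qed.

Lemma eq_of_prefix_sums s t N : all (fun v => 0 < v) s -> all (fun v => 0 < v) t ->
  size s <= N -> size t <= N ->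
  (forall k, k <= N -> sumn (take k s) = sumn (take k t)) -> s = t.
Proof.
move=> s_gt0 t_gt0 les let_ eq_st.
have eq_nth k : k < N -> nth 0 s k = nth 0 t k.
  move=> ltk; apply: (@addnI (sumn (take k s))).
  by rewrite -sumn_takeS eq_st // eq_st ?(ltnW ltk) // sumn_takeS.
have size_le (s1 s2 : seq nat) : all (fun v => 0 < v) s1 -> size s1 <= N ->
    (forall k, k < N -> nth 0 s1 k = nth 0 s2 k) -> size s1 <= size s2.
  move=> s1_gt0 le1 eq12; rewrite leqNgt; apply/negP => lt21.
  have := allP s1_gt0 _ (mem_nth 0 lt21).
  by rewrite (eq12 _ (leq_trans lt21 le1)) nth_default.
have eq_size : size s = size t.
  by apply/eqP; rewrite eqn_leq !size_le // => k /eq_nth.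
apply: (@eq_from_nth _ 0) => // k ltk.
by apply: eq_nth; apply: leq_trans les.
Qed.

Definition young_cells (s : seq nat) : seq (nat * nat) :=
  [seq (a, c) | a <- iota 0 (size s), c <- iota 0 (nth 0 s a)].

Lemma mem_young_cells s z : (z \in young_cells s) = (z.2 < nth 0 s z.1).
Proof.
case: z => a c; apply/allpairsPdep/idP => [[a' [c' []]] | /= ltc].
  by rewrite !mem_iota => _ ltc [-> ->].
exists a, c; split=> //; rewrite mem_iota //=.
by rewrite ltnNge; apply: contraL ltc => les; rewrite nth_default.
Qed.

Lemma uniq_young_cells s : uniq (young_cells s).
Proof.
apply: allpairs_uniq_dep => [|a _|]; rewrite ?iota_uniq //.
by move=> [a c] [a' c'] _ _ /= [-> ->].
Qed.

Lemma count_row_young_cells s j : count (fun z => z.1 == j) (young_cells s) = nth 0 s j.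
Proof.
rewrite /young_cells count_flatten -map_comp sumnE big_map.
rewrite (eq_bigr (fun a => (a == j) * nth 0 s a)); last first.
  move=> a _; rewrite /= count_map; case: eqP => /= [-> | ne].
    by rewrite mul1n (@eq_count _ _ predT) ?count_predT ?size_iota // => x /=; rewrite eqxx.
  by rewrite mul0n (@eq_count _ _ pred0) ?count_pred0 // => x /=; apply/eqP.
have [ltj | lej] := ltnP j (size s).
  rewrite (bigD1_seq j) ?mem_iota ?iota_uniq //= eqxx mul1n big1 ?addn0 //.
  by move=> a /negPf->.
rewrite nth_default // big1_seq // => a; rewrite mem_iota => /andP[_ lta].
by case: eqP lta => // ->; rewrite /= ltnNge lej.
Qed.

Lemma size_young_cells s : size (young_cells s) = sumn s.
Proof.
rewrite /young_cells size_allpairs_dep -{3}(mkseq_nth 0 s).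
by congr sumn; apply: eq_map => a; rewrite size_iota.
Qed.

End Compositions.

(** * Boxes of the diagrams and parts of the composition *)

Section PadicCells.
Variables (p : nat) (ls ms : seq (seq nat)).
Hypothesis p_gt0 : (0 < p)%N.
Local Open Scope nat_scope.

Lemma sumn_padd s t : sumn (padd s t) = sumn s + sumn t.
Proof.
pose N := maxn (size s) (size t).
rewrite !(@sumn_nth _ N) ?leq_maxl ?leq_maxr ?size_mkseq //.
by rewrite -big_split; apply: eq_bigr => j _; rewrite nth_padd.
Qed.

Lemma sumn_pscale k s : sumn (pscale k s) = k * sumn s.
Proof. by rewrite !sumnE big_map big_distrr. Qed.

Lemma sumn_psum ss N : size ss <= N ->
  sumn (psum p ss) = \sum_(i < N) p ^ i * sumn (nth [::] ss i).
Proof.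
elim: ss N => [|s ss IHss] N leN.
  by rewrite big1 // => i _; rewrite nth_nil muln0.
case: N leN => // N leN; rewrite /= sumn_padd sumn_pscale big_ord_recl mul1n /=.
rewrite (IHss N) // big_distrr /=; congr (_ + _); apply: eq_bigr => i _.
by rewrite /bump add1n expnS mulnA.
Qed.

(* A cell ((ty, i), (a, c)) is the box of row a and column c of the Young diagram
   of lambda(i) when [ty = false], and of mu(i - 1) when [ty = true]. *)
Definition shape (t : bool * nat) : seq nat :=
  if t.1 then (if t.2 is i.+1 then nth [::] ms i else [::]) else nth [::] ls t.2.

Definition top_level := maxn (size ls).-1 (size ms).
Definition levels : seq (bool * nat) :=
  [seq (b, i) | i <- iota 0 top_level.+1, b <- [:: false; true]].
(** Ordered by level, so that the sizes of the cells, read in order, are exactly the parts of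
    [Pcomp]. *)
Definition padic_cells : seq ((bool * nat) * (nat * nat)) :=
  [seq (t, z) | t <- levels, z <- young_cells (shape t)].
Definition cell_size (z : (bool * nat) * (nat * nat)) : nat := p ^ z.1.2.

Lemma mem_padic_cells z : (z \in padic_cells) = (z.2.2 < nth 0 (shape z.1) z.2.1).
Proof.
case: z => [[b i] z]; apply/allpairsPdep/idP => [[t [z' [_ + [-> ->]]]] | ltz].
  by rewrite mem_young_cells.
exists (b, i), z; split=> //; last by rewrite mem_young_cells.
apply/allpairsPdep; exists i, b; split=> //; last by case: b {ltz}; rewrite !inE.
rewrite mem_iota add0n ltnS /= leqNgt; apply: contraL ltz; rewrite gtn_max => /andP[lt_ls lt_ms].
rewrite -leqNgt /shape; case: b => /=.
  by case: i lt_ms {lt_ls} => [|i] lt_ms; rewrite ?nth_nil // (nth_default _ lt_ms) nth_nil.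
have le_ls : size ls <= i by case: (size ls) lt_ls.
by rewrite (nth_default _ le_ls) nth_nil.
Qed.

Lemma uniq_padic_cells : uniq padic_cells.
Proof.
apply: allpairs_uniq_dep => [|t _|]; rewrite ?uniq_young_cells //; last first.
  by move=> [t z] [t' z'] _ _ /= [-> ->].
apply: allpairs_uniq => //; first exact: iota_uniq.
by move=> [i b] [i' b'] _ _ /= [-> ->].
Qed.

Lemma map_cell_size : map cell_size padic_cells = Pcomp p ls ms.
Proof.
rewrite /padic_cells /levels /Pcomp -/top_level.
elim: (iota 0 top_level.+1) => //= i s IHs.
rewrite -IHs !map_cat -!map_comp catA; congr (_ ++ _).
have constE b : [seq cell_size ((b, i), z) | z <- young_cells (shape (b, i))] =
    nseq (sumn (shape (b, i))) (p ^ i).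
  by rewrite -size_young_cells; elim: (young_cells _) => //= z l ->.
rewrite (constE false) (constE true) -nseqD; congr nseq; rewrite /shape /=.
by case: i {IHs constE}.
Qed.

Lemma sum_levels (g : bool * nat -> nat) :
  \sum_(t <- levels) g t = \sum_(i < top_level.+1) (g (false, i : nat) + g (true, i : nat)).
Proof.
rewrite /levels big_allpairs_dep -(big_mkord predT (fun i => g (false, i) + g (true, i))).
rewrite /index_iota subn0; apply: eq_bigr => i _.
by rewrite !big_cons big_nil /= addn0.
Qed.

Let size_ls : size ls <= top_level.+1.
Proof. by apply: leq_trans (leqSpred _) _; rewrite ltnS leq_maxl. Qed.

Let size_ms : size ms <= top_level. Proof. exact: leq_maxr. Qed.

Lemma sumn_Pcomp : sumn (Pcomp p ls ms) = sumn (psum p ls) + p * sumn (psum p ms).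
Proof.
rewrite -map_cell_size sumnE big_map /padic_cells big_allpairs_dep.
rewrite (eq_bigr (fun t => p ^ t.2 * sumn (shape t))) => [|t _]; last first.
  by rewrite big_const_seq count_predT size_young_cells iter_addn addn0.
rewrite (sum_levels (fun t => p ^ t.2 * sumn (shape t))) big_split /=.
rewrite (sumn_psum size_ls) (sumn_psum size_ms) big_distrr; congr (_ + _) => /=.
rewrite big_ord_recl /= muln0 add0n; apply: eq_bigr => i _.
by rewrite /bump add1n expnS mulnA.
Qed.

(** Row [j] of a [p]-adic sum collects row [j] of all its diagrams, weighted by [p ^ i]. For [b]
    true the level exceeds the index in [ms] by one, whence the factor [p]. *)
Lemma sum_row_cells b j :
  \sum_(z <- padic_cells | (z.1.1 == b) && (z.2.1 == j)) cell_size z =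
  if b then p * nth 0 (psum p ms) j else nth 0 (psum p ls) j.
Proof.
rewrite big_mkcond big_allpairs_dep /=.
rewrite (eq_bigr (fun t => (t.1 == b) * (p ^ t.2 * nth 0 (shape t) j))) => [|t _]; last first.
  case: (t.1 == b) => /=; last by rewrite big1.
  by rewrite mul1n -big_mkcond big_const_seq iter_addn addn0 count_row_young_cells.
rewrite (sum_levels (fun t => (t.1 == b) * (p ^ t.2 * nth 0 (shape t) j))).
case: b.
  rewrite big_ord_recl /= nth_nil muln0 add0n (nth_psum _ _ size_ms).
  rewrite big_distrr; apply: eq_bigr => i _ /=.
  by rewrite add0n mul1n /bump add1n expnS mulnA.
rewrite (nth_psum _ _ size_ls).
by apply: eq_bigr => i _ /=; rewrite mul1n mul0n addn0.
Qed.

End PadicCells.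

Lemma linear_system_ext (F : fieldType) (gT : finGroupType) (H H' : {group gT})
    (s s' : gT -> F) n (rW : mx_representation F [set: gT]%G n) u phi :
  H :=: H' -> {in H, s =1 s'} -> linear_system H s rW u phi ->
  linear_system H' s' rW u phi.
Proof.
move=> /group_inj <- eq_s [uH phiH uphi tr1].
split=> // [h Hh | h Hh | g].
- by rewrite uH ?eq_s.
- by rewrite phiH ?eq_s.
by rewrite uphi; case: ifP => // /eq_s->.
Qed.

Lemma signed_perm_system (F : fieldType) n p (al be : seq nat) d
    (rW : mx_representation F [set: 'S_n]%G d) :
  is_signed_perm_module p al be rW ->
  let f (i : 'I_n) := blk (al ++ pscale p be) i in
  exists u phi,
    linear_system (stabf_group f) (set_sign F [set x | (size al <= f x)%N]) rW u phi.
Proof.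
case/induced_linear_system=> u [phi sysW] f; exists u, phi.
apply: linear_system_ext sysW => // g _ /=.
by rewrite /tsgn_mx mxE eqxx mulr1n.
Qed.

(** * Labels of the points and the final assembly *)

Section PadicPoints.
Variables (p n : nat) (ls ms : seq (seq nat)).
Local Open Scope nat_scope.
Hypotheses (pr_p : prime p) (p_gt2 : 2 < p).
Hypotheses (part_ls : all is_partition ls) (part_ms : all is_partition ms).
Hypotheses (restr_ls : all (p_restricted p) ls) (restr_ms : all (p_restricted p) ms).
Local Notation lam := (psum p ls).
Local Notation mu := (psum p ms).
Hypothesis def_n : sumn lam + p * sumn mu = n.
Local Notation rho := (Pcomp p ls ms).
Local Notation cells := (padic_cells ls ms).
Local Notation A := (size lam).

Let p_gt0 : 0 < p. Proof. exact: prime_gt0. Qed.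
Let def_rho : sumn rho = n. Proof. by rewrite sumn_Pcomp. Qed.

(** The blocks of [rho] are matched in order with the cells; by [blk_size] the default value is
    never reached. *)
Definition point_cell (x : 'I_n) := nth ((false, 0), (0, 0)) cells (blk rho x).

Let size_rho : size rho = size cells.
Proof. by rewrite -map_cell_size size_map. Qed.

Let blk_size (x : 'I_n) : blk rho x < size cells.
Proof. by rewrite -size_rho blk_lt ?take_size def_rho. Qed.

Lemma point_cell_in x : point_cell x \in cells.
Proof. exact: mem_nth. Qed.

Lemma point_cell_eq x y : (point_cell x == point_cell y) = (blk rho x == blk rho y).
Proof. by rewrite nth_uniq ?uniq_padic_cells. Qed.

Lemma card_point_cell z : #|[set x | point_cell x == z]| = (z \in cells) * cell_size p z.
Proof.
have [cz | ncz] := boolP (z \in cells); last first.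
  apply/eqP; rewrite cards_eq0; apply/eqP/setP=> x; rewrite !inE.
  by apply: contraNF ncz => /eqP <-; apply: point_cell_in.
rewrite mul1n -[z in RHS](nth_index ((false, 0), (0, 0)) cz).
rewrite -(nth_map _ 0) ?index_mem // map_cell_size -(card_blk_eq _ def_rho).
apply: eq_card => x; rewrite !inE -{1}(nth_index ((false, 0), (0, 0)) cz).
by rewrite /point_cell nth_uniq ?uniq_padic_cells ?index_mem.
Qed.

Lemma card_point_cells (P : pred ((bool * nat) * (nat * nat))) :
  #|[set x | P (point_cell x)]| = \sum_(z <- cells | P z) cell_size p z.
Proof.
rewrite -sum1_card; transitivity (\sum_(x : 'I_n) \sum_(z <- cells | P z) (point_cell x == z)).
  rewrite big_mkcond; apply: eq_bigr => x _; rewrite inE big_mkcond.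
  rewrite (bigD1_seq (point_cell x)) ?point_cell_in ?uniq_padic_cells //= eqxx.
  by rewrite big1 ?addn0 => [|z ne_z]; [case: ifP | rewrite eq_sym (negPf ne_z); case: ifP].
rewrite exchange_big /= !(big_seq_cond P); apply: eq_bigr => z /andP[cz _].
have := card_point_cell z; rewrite cz mul1n => <-; rewrite -sum1_card.
by rewrite [RHS]big_mkcond; apply: eq_bigr => x _; rewrite inE; case: eqP.
Qed.

Definition cell_ty x := (point_cell x).1.1.
Definition cell_lv x := (point_cell x).1.2.
Definition cell_row x := (point_cell x).2.1.
Definition cell_col x : (bool * nat) * nat := ((point_cell x).1, (point_cell x).2.2).
Definition cell_len x := count (fun v => (point_cell x).2.2 < v) (shape ls ms (point_cell x).1).
Definition row_label x := if cell_ty x then A + cell_row x else cell_row x.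

Lemma shape_partition t : sorted geq (shape ls ms t).
Proof.
have nth_part (ss : seq (seq nat)) i : all is_partition ss -> sorted geq (nth [::] ss i).
  have [lti | lei] := ltnP i (size ss); last by rewrite nth_default.
  by move/allP/(_ _ (mem_nth [::] lti))/andP=> [].
by case: t => [[] [|i]] //=; apply: nth_part.
Qed.

Lemma shape_restricted t j :
  nth 0 (shape ls ms t) j - nth 0 (shape ls ms t) j.+1 < p.
Proof.
have nth_restr (ss : seq (seq nat)) i : all (p_restricted p) ss ->
    nth 0 (nth [::] ss i) j - nth 0 (nth [::] ss i) j.+1 < p.
  have [lti | lei] := ltnP i (size ss); last by rewrite (nth_default _ lei) !nth_nil.
  move/allP/(_ _ (mem_nth [::] lti))/forallP.
  have [ltj | lej] := ltnP j (size (nth [::] ss i)); first by move/(_ (Ordinal ltj)).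
  by rewrite (nth_default _ lej) sub0n.
by case: t => [[] [|i]]; rewrite /shape /= ?nth_nil ?sub0n //; apply: nth_restr.
Qed.

Lemma mem_cell x : (point_cell x).2.2 < nth 0 (shape ls ms (point_cell x).1) (cell_row x).
Proof. by rewrite -mem_padic_cells // point_cell_in. Qed.

(** A box of [lambda(i)] in row [a] makes the corresponding part of [lam] nonzero. *)
Lemma row_unsigned i a c : c < nth 0 (shape ls ms (false, i)) a -> a < A.
Proof.
move=> ltc; rewrite ltnNge; apply/negP=> leA.
have : nth 0 lam a = 0 by rewrite nth_default.
rewrite -(sum_row_cells p ls ms false a) => /eqP; rewrite sum_nat_seq_eq0.
have cz : ((false, i), (a, c)) \in cells by rewrite mem_padic_cells.
by move/allP/(_ _ cz); rewrite /= !eqxx /= expn_eq0 [p == 0]eqn0Ngt p_gt0.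
Qed.

Lemma label_signed x : (A <= row_label x) = cell_ty x.
Proof.
rewrite /row_label; case tyx: (cell_ty x); first by rewrite leq_addr.
apply/negbTE; rewrite -ltnNge; have := mem_cell x; move: tyx; rewrite /cell_ty /cell_row.
by case: (point_cell x) => [[b i] [a c]] /= ->; apply: row_unsigned.
Qed.

Lemma rw_row x : rw row_label A x = cell_row x.
Proof. by rewrite /rw label_signed /row_label; case: (cell_ty x); rewrite ?addKn. Qed.

Lemma cell_point_cell x y :
  (cell cell_col row_label x == cell cell_col row_label y) = (point_cell x == point_cell y).
Proof.
apply/eqP/eqP=> [e | e].
  have rxy : cell_row x = cell_row y.
    by rewrite -!rw_row; apply: cell_rw e.
  case: e => e1 e2 _; move: e1 e2 rxy; rewrite /cell_row.
  by case: (point_cell x) (point_cell y) => [t [a c]] [t' [a' c']] /= -> -> ->.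
by rewrite /cell /cell_col /row_label /cell_ty /cell_row e.
Qed.

Lemma exists_point z : z \in cells -> exists x, point_cell x = z.
Proof.
move=> cz; have : 0 < #|[set x | point_cell x == z]|.
  by rewrite card_point_cell cz mul1n expn_gt0 p_gt0.
by rewrite card_gt0 => /set0Pn[x]; rewrite inE => /eqP; exists x.
Qed.

(** Thus [row_label] differs by a permutation of the points from the labelling by consecutive rows
    that defines [M(lam|p mu)]. *)
Lemma card_row_label t : #|[set x | row_label x == t]| = nth 0 (lam ++ pscale p mu) t.
Proof.
rewrite nth_cat; case: (ltnP t A) => [ltA | leA].
  transitivity #|[set x | (fun z => (z.1.1 == false) && (z.2.1 == t)) (point_cell x)]|.
    apply: eq_card => x; rewrite !inE /= -/(cell_ty x) -/(cell_row x).
    rewrite /row_label; case: (cell_ty x) => //=; apply/eqP => e.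
    by move: ltA; rewrite -e ltnNge leq_addr.
  by rewrite (card_point_cells (fun z => (z.1.1 == false) && (z.2.1 == t))) sum_row_cells.
transitivity #|[set x | (fun z => (z.1.1 == true) && (z.2.1 == t - A)) (point_cell x)]|.
  apply: eq_card => x; rewrite !inE /= -/(cell_ty x) -/(cell_row x).
  have := label_signed x; rewrite /row_label; case: (cell_ty x) => [_|] /=.
    by rewrite -{1}(subnKC leA) eqn_add2l.
  by apply: contraFF => /eqP->.
rewrite (card_point_cells (fun z => (z.1.1 == true) && (z.2.1 == t - A))) sum_row_cells.
by rewrite nth_pscale.
Qed.

(** The columns of length [l] in the diagram [s] have indices from [nth 0 s l] to below
    [nth 0 s l.-1], fewer than [p] of them by restrictedness. Each meets the row in one block. *)
Lemma few_blocks x :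
  #|[set y | [&& row_label y == row_label x, cell_len y == cell_len x &
                 cell_lv y == cell_lv x]]| < p ^ (cell_lv x).+1.
Proof.
pose s := shape ls ms (point_cell x).1; pose l := cell_len x.
have sorted_s : sorted geq s by apply: shape_partition.
have ltl : cell_row x < l by rewrite /l /cell_len -nth_partition // mem_cell.
pose r := iota (nth 0 s l) (nth 0 s l.-1 - nth 0 s l).
have size_r : size r < p.
  rewrite size_iota -{2}(prednK (leq_ltn_trans (leq0n _) ltl)).
  exact: shape_restricted.
pose z c : (bool * nat) * (nat * nat) := ((point_cell x).1, (cell_row x, c)).
apply: (@leq_ltn_trans (\sum_(c <- r) p ^ cell_lv x)); last first.
  rewrite big_const_seq count_predT iter_addn addn0 mulnC expnS.
  by rewrite ltn_pmul2r ?expn_gt0 ?p_gt0.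
apply: (@leq_trans (\sum_(c <- r) #|[set y | point_cell y == z c]|)); last first.
  by apply: leq_sum => c _; rewrite card_point_cell /cell_size; case: (_ \in _); rewrite ?mul1n.
rewrite -sum1_card.
apply: (@leq_trans (\sum_(y : 'I_n) \sum_(c <- r) (point_cell y == z c))); last first.
  rewrite exchange_big; apply: leq_sum => c _; rewrite -sum1_card [in leqRHS]big_mkcond.
  by apply: leq_sum => y _; rewrite inE; case: eqP.
rewrite big_mkcond; apply: leq_sum => y _; rewrite inE.
case: ifP => // /and3P[/eqP Ry /eqP ly /eqP lvy].
have tyy : cell_ty y = cell_ty x by rewrite -!label_signed Ry.
have ry : cell_row y = cell_row x by rewrite -!rw_row /rw Ry.
have shy : (point_cell y).1 = (point_cell x).1.
  move: tyy lvy; rewrite /cell_ty /cell_lv.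
  by case: (point_cell y).1 (point_cell x).1 => [? ?] [? ?] /= -> ->.
have cr : (point_cell y).2.2 \in r.
  have e c' a : (c' < nth 0 s a) = (a < count (fun v => c' < v) s) by apply: nth_partition.
  have lyE : count (fun v => (point_cell y).2.2 < v) s = l by rewrite /s -shy.
  rewrite mem_iota; apply/andP; split; first by rewrite leqNgt e lyE ltnn.
  rewrite subnKC; last first.
    rewrite leqNgt e; apply/negP=> ltl2; have := e (nth 0 s l.-1) l.-1.
    by rewrite ltnn (leq_ltn_trans (leq_pred _) ltl2).
  by rewrite e lyE prednK // (leq_ltn_trans _ ltl).
rewrite (big_rem _ cr) /= (_ : _ == _) ?leq_addr //; apply/eqP.
by rewrite /z -shy -ry /cell_row; case: (point_cell y) => [t [a c]].
Qed.

Variables (F : fieldType) (chp : (p \in [pchar F])%R).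
Variable Q : {group 'S_n}.
Hypothesis sylQ : (p.-Sylow(young n rho) Q)%g.
Local Notation labels := (cell cell_col row_label).

Lemma sylow_labels : (p.-Sylow(stabf_group labels) Q)%g.
Proof.
suff -> : stabf_group labels = young n rho by [].
apply: val_inj => /=; apply/setP=> s; rewrite !inE; apply: eq_forallb => x.
by rewrite cell_point_cell point_cell_eq.
Qed.

Let col_ty x y : cell_col x = cell_col y -> (A <= row_label x) = (A <= row_label y).
Proof. by rewrite !label_signed /cell_ty => -[->]. Qed.

Let col_lv x y : cell_col x = cell_col y -> cell_lv x = cell_lv y.
Proof. by rewrite /cell_lv => -[->]. Qed.

Let col_ln x y : cell_col x = cell_col y -> cell_len x = cell_len y.
Proof. by rewrite /cell_len => -[-> ->]. Qed.

Let card_labels x : #|block cell_col row_label x| = p ^ cell_lv x.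
Proof.
transitivity #|[set y | point_cell y == point_cell x]|.
  by apply: eq_card => y; rewrite !inE cell_point_cell.
by rewrite card_point_cell point_cell_in mul1n.
Qed.

Let lv_signed x : A <= row_label x -> 0 < cell_lv x.
Proof.
rewrite label_signed /cell_ty /cell_lv; have := mem_cell x; rewrite /shape.
by case: (point_cell x).1 => [[] [|i]]; rewrite //= nth_nil.
Qed.

Let rw_len x : rw row_label A x < cell_len x.
Proof. by rewrite rw_row /cell_len -nth_partition ?mem_cell ?shape_partition. Qed.

Let rw_onto x a : a < cell_len x ->
  exists2 y, cell_col y = cell_col x & rw row_label A y = a.
Proof.
rewrite /cell_len -nth_partition ?shape_partition // => lta.
have [|y yz] := @exists_point ((point_cell x).1, (a, (point_cell x).2.2)).
  by rewrite mem_padic_cells.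
by exists y; rewrite ?rw_row /cell_col /cell_row yz.
Qed.

Let len_unsigned x : row_label x < A -> cell_len x <= A.
Proof.
rewrite ltnNge label_signed => nty; rewrite leqNgt; apply/negP.
rewrite /cell_len -nth_partition ?shape_partition //.
move: nty; rewrite /cell_ty; case: (point_cell x) => [[b i] [a c]] /= /negPf->.
by move/row_unsigned; rewrite ltnn.
Qed.

Lemma card_lt_fibers (T : 'I_n -> nat) s k :
  (forall t, #|[set x | T x == t]| = nth 0 s t) ->
  #|[set x | T x < k]| = sumn (take k s).
Proof.
move=> fibT; elim: k => [|k IHk].
  by rewrite take0; apply/eqP; rewrite cards_eq0; apply/eqP/setP=> x; rewrite !inE.
rewrite sumn_takeS -IHk -fibT -cardsUI.
rewrite [X in _ + #|pred_of_set X|](_ : _ = set0) ?cards0 ?addn0.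
  by apply: eq_card => x; rewrite !inE ltnS [LHS]leq_eqVlt orbC.
by apply/setP=> x; rewrite !inE; case: ltngtP.
Qed.

Let take_min_cat (s t : seq nat) k : take (minn k (size s)) (s ++ t) = take k s.
Proof. by rewrite takel_cat ?geq_minr // take_min take_size. Qed.

Let take_add_cat (s t : seq nat) k : take (size s + k) (s ++ t) = s ++ take k t.
Proof. by rewrite take_cat ltnNge leq_addr /= addKn. Qed.

Lemma dominated_signed_perm (al be : seq nat) (T : 'I_n -> nat) :
    (forall t, #|[set x | T x == t]| = nth 0 (al ++ pscale p be) t) ->
    (forall q x, q \in Q -> T (q x) = T x) ->
    compatible cell_col row_label A Q T (size al) ->
  pair_dom (lam, pscale p mu) (al, pscale p be).
Proof.
move=> fibT TQ compT; apply/forallP=> k.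
have [] := compatible_dominated pr_p p_gt2 col_lv col_ty col_ln card_labels lv_signed
  rw_len rw_onto sylow_labels TQ compT k.
rewrite !(card_lt_fibers _ fibT) !(card_lt_fibers _ card_row_label).
by rewrite !take_min_cat !take_add_cat !sumn_cat => -> ->.
Qed.

(** Mutual dominance gives equal prefix sums; positivity of the parts excludes trailing zeros, which
    these sums would not see. *)
Lemma pair_dom_anti (al be ga de : seq nat) :
    all (fun v => 0 < v) al -> all (fun v => 0 < v) be ->
    all (fun v => 0 < v) ga -> all (fun v => 0 < v) de ->
  pair_dom (al, be) (ga, de) -> pair_dom (ga, de) (al, be) -> (al, be) = (ga, de).
Proof.
move=> al0 be0 ga0 de0 /forallP dom1 /forallP dom2.
pose N := size al + size be + size ga + size de.
have sums k : k <= N -> sumn (take k al) = sumn (take k ga) /\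
    sumn al + sumn (take k be) = sumn ga + sumn (take k de).
  rewrite -ltnS => ltk; have /andP[h1 h2] := dom1 (Ordinal ltk).
  have eN : (size ga + size de + size al + size be) = N by rewrite /N; ring.
  have ltk' : k < (size ga + size de + size al + size be).+1 by rewrite eN.
  have /andP[h3 h4] := dom2 (Ordinal ltk').
  by split; apply/eqP; rewrite eqn_leq ?h1 ?h3 ?h2 ?h4.
have eq1 : al = ga.
  apply: (@eq_of_prefix_sums al ga N) => // [||k /sums[]//].
    by rewrite /N -!addnA leq_addr.
  by rewrite /N addnAC leq_addl.
have eq2 : be = de.
  apply: (@eq_of_prefix_sums be de N) => // [||k /sums[_]].
  - by rewrite /N -!addnA addnCA leq_addr.
  - by rewrite /N leq_addl.
  by rewrite eq1 => /addnI.
by rewrite eq1 eq2.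
Qed.

Lemma signed_young_vertex d (rY : mx_representation F [set: 'S_n]%G d) :
    is_partition lam -> is_partition mu ->
    is_signed_young_module p lam mu rY -> vertex rY Q /\ trivial_source_at rY Q.
Proof.
have pos_part s : is_partition s -> all (fun v => 0 < v) s by case/andP.
have pos_pscale s : all (fun v => 0 < v) s -> all (fun v => 0 < v) (pscale p s).
  by move=> /allP s0; apply/allP=> _ /mapP[v /s0 v0 ->]; rewrite muln_gt0 p_gt0.
move=> part_lam part_mu [indY [dM [rM [dN [rN [permM simM _ sumN]]]]]].
have [u [phi sysM]] := signed_perm_system permM.
set f0 := (fun i : 'I_n => _) in sysM.
have sum0 : sumn (lam ++ pscale p mu) = n by rewrite sumn_cat sumn_pscale.
(* [g] carries the consecutive rows to the rows of [row_label], and the linear system of [M] is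
   conjugated accordingly. *)
have [t | g gP] := @perm_of_fibers n _ f0 row_label.
  by rewrite card_row_label card_blk_eq.
have sysR : linear_system (stabf_group row_label) (set_sign F (signed_points row_label A))
    rM (u *m rM g^-1%g) (rM g^-1^-1%g *m phi).
  apply: linear_system_ext (linear_system_conj g^-1%g sysM).
    rewrite /= stabf_conj invgK; apply/setP=> s; rewrite !inE.
    by apply: eq_forallb => x; rewrite /= !gP.
  move=> h; rewrite /= stabf_conj invgK => /stabfP hR.
  congr (_ ^+ nat_of_bool _)%R; rewrite -{1}[g]invgK.
  apply: restr_perm_conj => [x|]; first by rewrite !inE -gP permKV.
  by apply/astabsP=> x; rewrite !inE /= /aperm -!gP; have /= -> := hR x.
apply: (cells_vertex pr_p p_gt2 col_lv col_ty col_ln card_labels lv_signed rw_len rw_onto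
  few_blocks sylow_labels len_unsigned chp sysR indY simM).
(* A compatible labelling for [M(al|p be)] would make [(lam|p mu)] dominate [(al|p be)], which
   strictly dominates it. *)
apply: undetected_of_indecomposable => m rX indX sumX.
have [al [be [part_al part_be def_n' sdom [dV [rV [permV sumV]]]]]] := sumN _ _ indX sumX.
apply: undetected_summand sumV _; have [v [psi sysV]] := signed_perm_system permV.
apply: (undetected_of_incompatible pr_p p_gt2 col_ty card_labels sylow_labels chp sysV).
move=> T fibT TQ compT; case/andP: sdom => dom /eqP[]; apply: pair_dom_anti => //;
  try by [apply: pos_part | apply/pos_pscale/pos_part].
apply: (dominated_signed_perm (T := T)) => // t.
by rewrite fibT card_blk_eq // sumn_cat sumn_pscale.
Qed.

End PadicPoints.

Theorem theorem3p9 (F : closedFieldType) (p n : nat)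
    (lam mu : seq nat) (ls ms : seq (seq nat))
    (d : nat) (rY : mx_representation F [set: 'S_n]%G d) :
  p \in [pchar F] -> (3 <= p)%N ->
  is_partition lam -> is_partition mu ->
  (sumn lam + p * sumn mu)%N = n ->
  padic_expansion p lam ls -> padic_expansion p mu ms ->
  is_signed_young_module p lam mu rY ->
  forall Q : {group 'S_n}, (Q \in 'Syl_p(young n (Pcomp p ls ms)))%g ->
    vertex rY Q /\ trivial_source_at rY Q.
Proof.
move=> chp p_ge3 part_lam part_mu def_n [part_ls restr_ls _ _ lamE].
move=> [part_ms restr_ms _ _ muE] youngY Q; rewrite inE => sylQ.
rewrite lamE muE in part_lam part_mu def_n youngY.
exact: (signed_young_vertex (pcharf_prime chp) p_ge3 part_ls part_ms restr_ls
  restr_ms def_n chp sylQ part_lam part_mu youngY).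
Qed.
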